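(* Let $N\in[1,\infty)$. Suppose that a compact measured length space $(X,d,\nu)$ has nonnegative $N$-Ricci curvature, and that minimizing geodesics in $X$ are almost-everywhere unique, in the sense that for $\nu\otimes\nu$-almost all $(x_0,x_1)\in X\times X$ there is a unique $\gamma\in\Gamma$ with $\gamma(0)=x_0$ and $\gamma(1)=x_1$. Then $(X,d,\nu)$ satisfies $\mathrm{DM}(2^N)$.
   Context: A compact measured length space $(X,d,\nu)$ is a compact length space $(X,d)$ equipped with a Borel probability measure $\nu$. Balls are $B_r(x)=\{y\in X: d(x,y)<r\}$. $\Gamma$ is the set of minimizing constant-speed geodesics $\gamma:[0,1]\to X$, $e_t(\gamma)=\gamma(t)$, $E=(e_0,e_1):\Gamma\to X\times X$. $P(X)$ is the set of Borel probability measures on $X$. $\mathrm{DM}(C)$: for $\mu\in P(X)$, a dynamical democratic transference plan from $\mu$ to itself is $\Pi\in P(\Gamma)$ with $E_*\Pi=\mu\otimes\mu$. Given $C>0$, $(X,d,\nu)$ satisfies $\mathrm{DM}(C)$ if for each ball $B\subset X$ with $\nu[B]>0$ there is a dynamical democratic transference plan $\Pi$ from $\mu=\frac{1_B}{\nu[B]}\nu$ to itself such that, with $\mu_t=(e_t)_*\Pi$, $\int_0^1\mu_t\,dt\le\frac{C}{\nu[B]}\nu$ as measures. Nonnegative $N$-Ricci curvature: for $N\in[1,\infty)$, $\mathcal{DC}_N$ is the set of continuous convex functions $U:[0,\infty)\to\mathbb{R}$ with $U(0)=0$ such that $\lambda\mapsto\lambda^N U(\lambda^{-N})$ is convex on $(0,\infty)$.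 Put $U'(\infty)=\lim_{r\to\infty}U(r)/r$ and, for $\mu\in P(X)$ with Lebesgue decomposition $\mu=\rho\,\nu+\mu_s$ with respect to $\nu$, $U_\nu(\mu)=\int_X U(\rho)\,d\nu+U'(\infty)\,\mu_s(X)$ (with $\infty\cdot0=0$). A Wasserstein geodesic is a minimizing constant-speed geodesic $\{\mu_t\}_{t\in[0,1]}$ in $P(X)$ with the 2-Wasserstein metric $W_2$. $(X,d,\nu)$ has nonnegative $N$-Ricci curvature if for all $\mu_0,\mu_1\in P(X)$ with support in $\mathrm{supp}(\nu)$ there is some Wasserstein geodesic $\{\mu_t\}_{t\in[0,1]}$ from $\mu_0$ to $\mu_1$ such that for all $U\in\mathcal{DC}_N$ and all $t\in[0,1]$, $U_\nu(\mu_t)\le (1-t)\,U_\nu(\mu_0)+t\,U_\nu(\mu_1)$. *)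

(* Defs.v *)
From HB Require Import structures.
From mathcomp Require Import all_boot all_order all_algebra.
From mathcomp Require Import all_classical all_reals all_analysis.
From mathcomp Require Import measurable_realfun.

Set Implicit Arguments.
Unset Strict Implicit.
Unset Printing Implicit Defensive.

Import Order.TTheory GRing.Theory Num.Theory.
Import numFieldTopology.Exports numFieldNormedType.Exports.

Local Open Scope classical_set_scope.
Local Open Scope ring_scope.

(* Measurable types are pointed in the library; a metric space that carries a
   probability measure is nonempty, so this is no restriction. *)
#[short(type="pmetricType")]
HB.structure Definition PointedMetric (K : numDomainType) :=
  {M of Metric K M & Pointed M}.

Notation borel T := (g_sigma_algebraType (@open T)).

Section measure_preliminaries.
Context {d : measure_display} {T : measurableType d} {R : realType}.
Implicit Types m : set T -> \bar R.
Local Open Scope ereal_scope.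

(* A measure in the library is a function on all subsets, whose values outside
   of the sigma-algebra are irrelevant: hence equality and domination of
   measures are only tested on measurable sets. *)
Definition measure_eq m1 m2 : Prop := forall A, measurable A -> m1 A = m2 A.

Definition measure_le m1 m2 : Prop := forall A, measurable A -> m1 A <= m2 A.

Definition lebesgue_decomposition (nu mu : {measure set T -> \bar R})
    (rho : T -> R) (mus : {measure set T -> \bar R}) : Prop :=
  [/\ measurable_fun [set: T] rho,
      forall x, (0 <= rho x)%R,
      exists2 A, measurable A & nu A = 0 /\ mus (~` A) = 0 &
      forall A, measurable A -> mu A = \int[nu]_(x in A) (rho x)%:E + mus A].

Lemma lebesgue_decomposition_exists (nu mu : probability T R) :
  exists rho (mus : {measure set T -> \bar R}),
    lebesgue_decomposition nu mu rho mus.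
Proof.
pose la0 : {measure set T -> \bar R} :=
  msum (fun n => if n is 0%N then nu else mu : {measure set T -> \bar R}) 2.
have la0E A : la0 A = nu A + mu A := measure_addE nu mu A.
have la0oo : la0 [set: T] < +oo by rewrite la0E !probability_setT -EFinD ltry.
pose la : {finite_measure set T -> \bar R} := mfrestr measurableT la0oo.
have laE A : la A = nu A + mu A by rewrite -la0E -[in RHS](setIT A).
have nula : nu `<< la.
  apply/null_content_dominatesP => A mA laA0.
  have /eqP : nu A + mu A = 0 by rewrite -laE.
  by rewrite padde_eq0 ?measure_ge0// => /andP[/eqP].
have [f [f0 ffin fint fE]] := radon_nikodym_sigma_finite nula.
have mf := measurable_int _ fint.
pose N := f @^-1` [set 0].
have mN : measurable N by rewrite -[N]setTI; exact: mf.
have nuN : nu N = 0.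
  rewrite fE//; transitivity (\int[la]_(x in N) (cst 0 x)).
    by apply: eq_integral => x; rewrite inE.
  exact: integral0.
have muoo (A : set T) (mA : measurable A) : mu A < +oo.
  by rewrite ltey_eq fin_num_measure.
pose mus : {measure set T -> \bar R} := mrestr mu mN.
have mNC := measurableC mN.
pose mua : {finite_measure set T -> \bar R} := mfrestr mNC (muoo _ mNC).
have mua_nu : mua `<< nu.
  apply/null_content_dominatesP => A mA nuA0.
  have : \int[la]_(x in A) `|f x| = 0.
    transitivity (nu A); last exact: nuA0.
    by rewrite fE//; apply: eq_integral => x _; rewrite gee0_abs.
  have mfA := measurable_funS measurableT (@subsetT _ A) mf.
  move=> /(ae_eq_integral_abs la mA mfA)[B [mB laB0 sB]].
  have muB0 : mu B = 0.
    have /eqP : nu B + mu B = 0 by rewrite -laE.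
    by rewrite padde_eq0 ?measure_ge0// => /andP[_ /eqP].
  apply: (@subset_measure0 _ _ _ mu _ B) => //; first exact: measurableI.
  by move=> x [Ax Nx]; apply: sB => /= /(_ Ax).
have [g [g0 gfin gint gE]] := radon_nikodym_sigma_finite mua_nu.
have mg := measurable_int _ gint.
exists (fine \o g), mus; split.
- exact: measurableT_comp.
- by move=> x /=; exact: fine_ge0.
- exists N => //; split => //.
  by rewrite /mus/= /mrestr setICl measure0.
- move=> A mA; transitivity (mua A + mus A).
    rewrite /mua /mus/= /mfrestr /mrestr [LHS](measureDI _ mA mN)//.
  congr (_ + _); rewrite gE//; apply: eq_integral => x _ /=.
  by rewrite fineK.
Qed.

Lemma lebesgue_decomposition_unique (nu mu : probability T R) rho1 rho2
    (mus1 mus2 : {measure set T -> \bar R}) :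
  lebesgue_decomposition nu mu rho1 mus1 ->
  lebesgue_decomposition nu mu rho2 mus2 ->
  ae_eq nu [set: T] rho1 rho2 /\ measure_eq mus1 mus2.
Proof.
move=> [mr1 r10 [A1 mA1 [nuA1 musA1]] E1] [mr2 r20 [A2 mA2 [nuA2 musA2]] E2].
pose B := A1 `|` A2.
have mB : measurable B by exact: measurableU.
have nuB : nu B = 0 by rewrite /B measureU0.
have musB rho (mus : {measure set T -> \bar R}) A :
    measurable A -> A `<=` B -> mus (~` A) = 0 -> measurable_fun [set: T] rho ->
    (forall C, measurable C ->
      mu C = \int[nu]_(x in C) (rho x)%:E + mus C) ->
    forall C, measurable C -> mus C = mu (C `&` B).
  move=> mA AB musA mrho E C mC; have mCB := measurableI _ _ mC mB.
  rewrite E// null_set_integral//; last 2 first.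
  - exact/measurable_EFinP/measurable_funTS.
  - by apply: (@subset_measure0 _ _ _ nu _ B) => //; exact: subIsetr.
  rewrite add0e -[in LHS](setIT C) -(setUv B) setIUr measureU0//.
    exact/measurableI/measurableC.
  apply: (@subset_measure0 _ _ _ mus _ (~` A)) => //.
  - exact/measurableI/measurableC.
  - exact/measurableC.
  - by move=> x [_ Bx] /AB.
have mus12 : measure_eq mus1 mus2.
  move=> C mC.
  rewrite (musB _ _ _ mA1 (@subsetUl _ _ _) musA1 mr1 E1)//.
  by rewrite (musB _ _ _ mA2 (@subsetUr _ _ _) musA2 mr2 E2).
split => //.
have mus1fin C : measurable C -> mus1 C \is a fin_num.
  move=> mC; rewrite (musB _ _ _ mA1 (@subsetUl _ _ _) musA1 mr1 E1)//.
  by rewrite fin_num_measure//; exact: measurableI.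
suff : ae_eq nu [set: T] (EFin \o rho1) (EFin \o rho2).
  by apply: filterS => x /= + _ => /(_ I)[].
apply: integral_ae_eq => //.
- apply/integrableP; split; first exact/measurable_EFinP.
  under eq_integral do rewrite gee0_abs ?lee_fin//.
  have E1T : \int[nu]_x (rho1 x)%:E + mus1 [set: T] = 1.
    by rewrite -E1//; exact: probability_setT.
  have : \int[nu]_x (rho1 x)%:E <= 1.
    by rewrite -E1T leeDl.
  by move/le_lt_trans; apply; rewrite ltry.
- exact/measurable_EFinP.
- move=> C _ mC; have := E1 _ mC; rewrite E2// -(mus12 _ mC).
  by move/(congr1 (fun x => x - mus1 C)); rewrite !addeK ?mus1fin// => ->.
Qed.

End measure_preliminaries.

Section length_spaces.
Context {R : realType} {X : metricType R}.
Implicit Types g : R -> X.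

Definition curve_length g : \bar R :=
  ereal_sup [set (let F n := g (nth 0 (0 :: s) n) in
                  \sum_(0 <= n < size s) mdist (F n) (F n.+1))%:E
            | s in itv_partition (0 : R) 1].

Definition is_length_space : Prop := forall x y : X,
  (mdist x y)%:E = ereal_inf
    [set curve_length g | g in
      [set g : R -> X | {within `[0, 1], continuous g} /\ g 0 = x /\ g 1 = y]].

Definition minimizing_geodesic g : Prop :=
  forall s t, s \in `[0, 1] -> t \in `[0, 1] ->
    mdist (g s) (g t) = `|s - t| * mdist (g 0) (g 1).

End length_spaces.
Arguments is_length_space {R} X.

(* A geodesic [0, 1] -> X is represented by its extension to R that is constant
   on ]-oo, 0] and on [1, +oo[, so that equality of geodesics is equality on
   [0, 1].  The set of geodesics, seen as a type, has the topology of uniform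
   convergence on [0, 1]. *)
Definition geodesics {R : realType} (X : metricType R) :
    set {uniform` `[0 : R, 1]%classic -> X} :=
  [set g | minimizing_geodesic (g : R -> X) /\
    forall t, g t = g (Num.max 0 (Num.min t 1))].

Arguments geodesics {R} X.

Definition geodesic {R : realType} (X : metricType R) : Type := geodesics X.

HB.instance Definition _ {R : realType} (X : metricType R) :=
  Topological.on (geodesic X).

Section geodesic_pointed.
Context {R : realType} (X : pmetricType R).

Lemma cst_geodesic :
  ((fun=> point) : {uniform` `[0 : R, 1]%classic -> X}) \in geodesics X.
Proof. by rewrite inE; split => // s t _ _; rewrite !mdistxx mulr0. Qed.

HB.instance Definition _ :=
  isPointed.Build (geodesic X) (SigSub cst_geodesic).

End geodesic_pointed.

Section evaluation.
Context {R : realType} {X : metricType R}.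

Definition ev (t : R) (g : geodesic X) : X := (set_val g : R -> X) t.

Definition endpoints (g : geodesic X) : X * X := (ev 0 g, ev 1 g).

End evaluation.

Section wasserstein.
Context {R : realType} {X : pmetricType R}.
Local Open Scope ereal_scope.

(* X * X carries the product sigma-algebra, which is its Borel sigma-algebra
   when X is separable, in particular when X is compact. *)
Definition coupling (mu0 mu1 : probability (borel X) R) :
    set (probability (borel X * borel X)%type R) :=
  [set pi |
    measure_eq (pushforward pi (fst : borel X * borel X -> borel X)) mu0 /\
    measure_eq (pushforward pi (snd : borel X * borel X -> borel X)) mu1].

Definition W2 (mu0 mu1 : probability (borel X) R) : \bar R :=
  (ereal_inf [set \int[pi]_z (mdist (z.1 : X) (z.2 : X) ^+ 2)%:E
             | pi in coupling mu0 mu1]) `^ 2^-1.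

Definition wasserstein_geodesic (mu : R -> probability (borel X) R) : Prop :=
  forall s t : R, s \in `[0%R, 1%R] -> t \in `[0%R, 1%R] ->
    W2 (mu s) (mu t) = `|s - t|%:E * W2 (mu 0%R) (mu 1%R).

Definition msupport (mu : probability (borel X) R) : set X :=
  [set x | forall A : set X, open A -> A x -> 0 < mu A].

End wasserstein.

Section ricci.
Context {R : realType} {X : pmetricType R}.
Implicit Types (N : R) (U : R -> R).
Local Open Scope ereal_scope.

(* U stands for a function on [0, +oo[: its values at negative numbers are
   never used. *)
Definition DC N U : Prop :=
  [/\ {within (`[0%R, +oo[ : set R), continuous U},
      convex_function (`[0%R, +oo[%classic : set R^o) U,
      U 0%R = 0%R &
      convex_function (`]0%R, +oo[%classic : set R^o)
        (fun l => l `^ N * U (l `^ (- N)))%R].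

Definition slope_at_infinity U : \bar R := lim ((U r / r)%:E @[r --> +oo%R]).

(* The value does not depend on the choice of a Lebesgue decomposition, by
   lebesgue_decomposition_exists and entropyE.  The library's conventions
   give +oo * 0 = 0. *)
Definition entropy U (nu mu : probability (borel X) R) : \bar R :=
  get [set v | exists rho mus, lebesgue_decomposition nu mu rho mus /\
    v = \int[nu]_x (U (rho x))%:E + slope_at_infinity U * mus [set: X]].

Lemma entropyE N U (nu mu : probability (borel X) R) rho
    (mus : {measure set (borel X) -> \bar R}) :
  DC N U -> lebesgue_decomposition nu mu rho mus ->
  entropy U nu mu =
    \int[nu]_x (U (rho x))%:E + slope_at_infinity U * mus [set: X].
Proof.
move=> [cU _ _ _].
have mU (rho' : borel X -> R) : measurable_fun [set: borel X] rho' ->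
    (forall x, 0 <= rho' x)%R -> measurable_fun [set: borel X] (U \o rho').
  move=> mr r0.
  apply: (@measurable_comp _ _ _ (borel X) R R (`[0%R, +oo[%classic : set R)) => //.
  - by move=> _ [x _ <-] /=; rewrite in_itv /= r0.
  - exact: subspace_continuous_measurable_fun.
have uniq (rho1 rho2 : borel X -> R)
    (mus1 mus2 : {measure set (borel X) -> \bar R}) :
    lebesgue_decomposition nu mu rho1 mus1 ->
    lebesgue_decomposition nu mu rho2 mus2 ->
    \int[nu]_x (U (rho1 x))%:E + slope_at_infinity U * mus1 [set: X] =
    \int[nu]_x (U (rho2 x))%:E + slope_at_infinity U * mus2 [set: X].
  move=> D1 D2; have [rE musE] := lebesgue_decomposition_unique D1 D2.
  rewrite (musE _ measurableT); congr (_ + _).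
  case: D1 D2 => [mr1 r10 _ _] [mr2 r20 _ _].
  apply: ae_eq_integral => //.
  - by apply/measurable_EFinP; apply: mU.
  - by apply/measurable_EFinP; apply: mU.
  - by apply: filterS rE => x /= + _ => ->.
move=> D; rewrite /entropy; case: xgetP => [v _ [rho' [mus' [D' ->]]]|].
  exact: uniq.
by move=> /(_ _ (ex_intro _ rho (ex_intro _ mus (conj D erefl)))).
Qed.

Definition nonnegative_Ricci N (nu : probability (borel X) R) : Prop :=
  forall mu0 mu1 : probability (borel X) R,
    msupport mu0 `<=` msupport nu -> msupport mu1 `<=` msupport nu ->
    exists mu : R -> probability (borel X) R,
      [/\ wasserstein_geodesic mu,
          measure_eq (mu 0%R) mu0, measure_eq (mu 1%R) mu1 &
          forall U, DC N U -> forall t : R, t \in `[0%R, 1%R] ->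
            entropy U nu (mu t) <=
              (1 - t)%:E * entropy U nu mu0 + t%:E * entropy U nu mu1].

End ricci.

Section democratic.
Context {R : realType} {X : pmetricType R}.
Local Open Scope ereal_scope.

Lemma measurable_metric_ball (x : X) (r : R) :
  measurable (ball x r : set (borel X)).
Proof.
apply: sub_sigma_algebra; rewrite openE => y.
rewrite ballEmdist /= => xyr; rewrite /interior.
apply/nbhs_ballP; exists (r - mdist x y)%R => /=; first by rewrite subr_gt0.
move=> z; rewrite !ballEmdist /= => yz.
by rewrite (le_lt_trans (metric_triangle _ y _))// -ltrBrDl.
Qed.

(* 1_B / nu[B] * nu for B = B_r(x); the fallback argument nu of mnormalize is
   only used if nu[B] = 0. *)
Definition ball_measure (nu : probability (borel X) R) (x : X) (r : R) :
    probability (borel X) R :=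
  mnormalize (mrestr nu (measurable_metric_ball x r)) nu.

Definition democratic_plan (mu : probability (borel X) R)
    (Pi : probability (borel (geodesic X)) R) : Prop :=
  measure_eq
    (pushforward Pi (endpoints : borel (geodesic X) -> borel X * borel X))
    (mu \x mu).

Definition DM (C : R) (nu : probability (borel X) R) : Prop :=
  forall (x : X) (r : R), 0 < nu (ball x r) ->
  exists2 Pi : probability (borel (geodesic X)) R,
    democratic_plan (ball_measure nu x r) Pi &
    measure_le
      (fun A => \int[lebesgue_measure]_(t in `[0%R, 1%R])
        pushforward Pi (ev t : borel (geodesic X) -> borel X) A)
      (fun A => (C / fine (nu (ball x r)))%:E * nu A).

Definition ae_unique_geodesics (nu : probability (borel X) R) : Prop :=
  {ae (nu \x nu), forall z : borel X * borel X,
    exists! g : geodesic X, endpoints g = z}.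

End democratic.

(* Main.v *)
Require Import Defs.
From mathcomp Require Import all_boot all_order all_algebra.
From mathcomp Require Import all_classical all_reals all_analysis.
From mathcomp Require Import measurable_realfun.
From mathcomp Require Import ring lra.

Set Implicit Arguments.
Unset Strict Implicit.
Unset Printing Implicit Defensive.

Import Order.TTheory GRing.Theory Num.Theory.
Import numFieldTopology.Exports numFieldNormedType.Exports.

Local Open Scope classical_set_scope.
Local Open Scope ring_scope.

(** Let [mu] be the normalized restriction of [nu] to a ball [B] of positive
    measure. Draw [(x, y)] with law [mu \x mu] and join [x] to [y] by their
    geodesic, which is almost surely unique: the law of this random geodesic
    is the plan, and its endpoints have the required law. What has to be shown
    is that its position at time [t] has density at most [2^N / nu B] with
    respect to [nu].

    Fix [x], and let [phi_t] send [y] to the point at time [t] of the geodesic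
    from [x] to [y]. The heart of the proof ([Ricci_contraction_closed],
    [Ricci_contraction]) is that [phi_t] contracts volume by a factor [t^N] at
    most: if [phi_t] maps [A] into [Z], then [t^N * nu A <= nu Z]. The
    curvature hypothesis gives a Wasserstein geodesic [mu_t] from the Dirac
    mass at [x] to the uniform measure on [A]. Mass can only travel along
    minimizing geodesics, so [mu_t] lives on [Z]
    ([wasserstein_geodesic_concentrated]). Take [U r = - r^(1 - 1/s)] with
    [s > N]. The entropy of the uniform measure on [A] is
    [- (nu A)^(1/s)], that of the Dirac mass is nonpositive, and that of a
    measure living on [Z] is at least [- (nu Z)^(1/s)] by Young's inequality;
    convexity along [mu_t] then reads [t * (nu A)^(1/s) <= (nu Z)^(1/s)].
    The exponent [s = N] is reached in the limit only, because for [N = 1]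
    this [U] is not continuous at [0].

    Averaging over [x], the position at time [t] has density at most
    [t^(-N) / nu B]; averaging over [y] instead, with the geodesics run
    backwards, it has density at most [(1 - t)^(-N) / nu B]. One of [t] and
    [1 - t] is at least [1/2].

    Two facts about geodesics underlie this. In a compact length space any two
    points are joined by a geodesic, and a point which splits their distance
    in the ratio [t : 1 - t] lies on one at time [t]; uniqueness then
    identifies it with [phi_t y]. And the geodesics form a compact space, so
    that the choice of the unique geodesic is measurable
    ([measurable_geodesic_selector]). *)

(** * Convergence of distances, limits along ultrafilters *)

Section metric_convergence.
Context {R : realType} {X : metricType R}.
Implicit Types x y : X.

Lemma mdist_quadrangle x y x' y' :
  `|mdist x y - mdist x' y'| <= mdist x x' + mdist y y'.
Proof.
have t1 := metric_triangle x x' y; have t2 := metric_triangle x' y' y.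
have t3 := metric_triangle x' x y'; have t4 := metric_triangle x y y'.
move: t1 t2 t3 t4; rewrite (metric_sym x' x) (metric_sym y' y).
move=> t1 t2 t3 t4; apply/ler_normlP; split; lra.
Qed.

Lemma cvg_mdist (T : Type) (F : set_system T) {FF : Filter F} (f g : T -> X)
    x y :
  f @ F --> x -> g @ F --> y -> mdist (f t) (g t) @[t --> F] --> mdist x y.
Proof.
move=> fx gy; apply/cvgrPdist_le => e e0.
have e20 : 0 < e / 2 by rewrite divr_gt0.
have Hf := @metricType_numDomainType.cvgr_dist_le _ _ _ _ FF _ _ fx _ e20.
have Hg := @metricType_numDomainType.cvgr_dist_le _ _ _ _ FF _ _ gy _ e20.
move: Hf Hg; apply: (@filterS2 _ F) => t Hf Hg.
by rewrite (le_trans (mdist_quadrangle _ _ _ _))// (splitr e) lerD.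
Qed.

Lemma continuous_mdist : continuous (fun z : X * X => mdist z.1 z.2).
Proof. by move=> z; apply: cvg_mdist; [exact: cvg_fst|exact: cvg_snd]. Qed.

Lemma continuous_mdistl x : continuous (mdist x).
Proof. by move=> z; apply: cvg_mdist; [exact: cvg_cst|exact: cvg_id]. Qed.

Lemma continuous_mdistr x : continuous (mdist ^~ x).
Proof. by move=> z; apply: cvg_mdist; [exact: cvg_id|exact: cvg_cst]. Qed.

End metric_convergence.

(** Applied at each time separately, this gives pointwise limits of families of
    curves along a single ultrafilter, with no diagonal extraction. *)
Lemma ultra_compact_cvg (T : Type) (X : topologicalType) (F : set_system T)
    (f : T -> X) :
  compact [set: X] -> UltraFilter F -> exists x : X, f @ F --> x.
Proof.
move=> cX FU.
have [x [_ clx]] : [set: X] `&` cluster (f @ F) !=set0.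
  exact: cX _ _ filterT.
exists x => V Vx; have [//|FnV] := in_ultra_setVsetC (f @^-1` V) FU.
by have [y []] := clx (~` V) V FnV Vx.
Qed.

(** * Geodesics in compact length spaces *)

Section geodesics_in_length_spaces.
Context {R : realType} {X : metricType R}.
Implicit Types (x y z : X) (g c : R -> X).

Lemma curve_length_ge3 c (u v : R) : 0 <= u -> u <= v -> v <= 1 ->
  ((mdist (c 0) (c u) + mdist (c u) (c v) + mdist (c v) (c 1))%:E
    <= curve_length c)%E.
Proof.
move=> u0 uv v1.
have sumE s : itv_partition (0 : R) 1 s ->
    ((\sum_(0 <= n < size s)
        mdist (c (nth 0 (0 :: s) n)) (c (nth 0 (0 :: s) n.+1)))%:E
      <= curve_length c)%E.
  by move=> ps; apply: ereal_sup_ubound; exists s.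
(* A partition is strictly increasing, so coinciding points are dropped. *)
have [u0'|u0'] := eqVneq u 0; have [vu|vu] := eqVneq v u;
  have [v1'|v1'] := eqVneq v 1.
- by move: v1'; rewrite vu u0' => /eqP; rewrite eq_sym oner_eq0.
- have := sumE [:: 1].
  rewrite big_nat1/= vu u0' !mdistxx !add0r; apply.
  by split => /=; rewrite ?andbT ?eqxx.
- have := sumE [:: 1].
  rewrite big_nat1/= v1' u0' !mdistxx addr0 add0r; apply.
  by split => /=; rewrite ?andbT ?eqxx.
- have v0 : 0 < v by rewrite -u0' lt_neqAle uv eq_sym vu.
  have v1'' : v < 1 by rewrite lt_neqAle v1 v1'.
  have := sumE [:: v; 1].
  rewrite /= big_nat_recl// big_nat1/= u0' mdistxx add0r; apply.
  by split => //=; rewrite v0 v1''.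
- have := sumE [:: 1].
  rewrite big_nat1/= -vu v1' !mdistxx !addr0; apply.
  by split => /=; rewrite ?andbT ?eqxx.
- have v0 : 0 < v by rewrite vu lt_neqAle u0 eq_sym u0'.
  have v1'' : v < 1 by rewrite lt_neqAle v1 v1'.
  have := sumE [:: v; 1].
  rewrite /= big_nat_recl// big_nat1/= -vu mdistxx addr0; apply.
  by split => //=; rewrite v0 v1''.
- have u0'' : 0 < u by rewrite lt_neqAle u0 eq_sym u0'.
  have u1 : u < 1 by rewrite -v1' lt_neqAle uv eq_sym vu.
  have := sumE [:: u; 1].
  rewrite /= big_nat_recl// big_nat1/= v1' mdistxx addr0; apply.
  by split => //=; rewrite u0'' u1.
- have u0'' : 0 < u by rewrite lt_neqAle u0 eq_sym u0'.
  have v1'' : v < 1 by rewrite lt_neqAle v1 v1'.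
  have uv' : u < v by rewrite lt_neqAle uv eq_sym vu.
  have := sumE [:: u; v; 1].
  rewrite /= !big_nat_recl// big_geq//= addr0 -addrA; apply.
  by split => //=; rewrite u0'' uv' v1''.
Qed.

(** Speed at most [d (g 0) (g 1)] suffices, because the triangle inequality
    along [0 <= s <= t <= 1] leaves no slack. *)
Lemma lipschitz_minimizing_geodesic g :
  (forall s t, s \in `[0, 1] -> t \in `[0, 1] -> s <= t ->
    mdist (g s) (g t) <= (t - s) * mdist (g 0) (g 1)) ->
  minimizing_geodesic g.
Proof.
move=> H.
have H' s t : s \in `[0, 1] -> t \in `[0, 1] -> s <= t ->
    mdist (g s) (g t) = (t - s) * mdist (g 0) (g 1).
  move=> s01 t01 st; apply/eqP; rewrite eq_le H//=.
  have I0 : (0 : R) \in `[0, 1] by rewrite in_itv/= lexx ler01.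
  have I1 : (1 : R) \in `[0, 1] by rewrite in_itv/= lexx ler01.
  have := s01; have := t01; rewrite !in_itv/= => /andP[t0 t1] /andP[s0 s1].
  have := H _ _ I0 s01 s0; have := H _ _ t01 I1 t1.
  have := metric_triangle (g 0) (g s) (g 1).
  have := metric_triangle (g s) (g t) (g 1).
  move: (mdist (g 0) (g 1)) => D; lra.
move=> s t s01 t01; have [st|/ltW ts] := leP s t.
  by rewrite H'// ler0_norm ?subr_le0// opprB.
by rewrite metric_sym (H' t s)// ger0_norm ?subr_ge0.
Qed.

Lemma eq_minimizing_geodesic g g' : {in `[0, 1], g =1 g'} ->
  minimizing_geodesic g -> minimizing_geodesic g'.
Proof.
move=> gg' mg s t s01 t01.
have I0 : (0 : R) \in `[0, 1] by rewrite in_itv/= lexx ler01.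
have I1 : (1 : R) \in `[0, 1] by rewrite in_itv/= lexx ler01.
by rewrite -!gg'// mg.
Qed.

(** Take a curve [c] of length at most [d(x, y) + e] and a time [w s] at which
    its distance to [x] is [s * d(x, y)]. The excess of length bounds
    [d(c (w s), c (w t)) - |t - s| * d(x, y)] by [e], whichever of [w s] and
    [w t] comes first; [w] need not be monotone. *)
Lemma almost_minimizing_geodesic x y (e : R) : is_length_space X -> 0 < e ->
  exists g, [/\ g 0 = x, g 1 = y & forall s t, s \in `[0, 1] -> t \in `[0, 1] ->
    s <= t -> mdist (g s) (g t) <= (t - s) * mdist x y + e].
Proof.
move=> lX e0.
have [_ [c [cc [c0 c1]] <-] lc] : exists2 l : \bar R, [set curve_length g | g in
      [set g : R -> X | {within `[0, 1], continuous g} /\ g 0 = x /\ g 1 = y]] l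
      & (l < (mdist x y + e)%:E)%E.
  by apply/ereal_inf_lt; rewrite -lX lte_fin ltrDl.
set d := mdist x y in lc *.
have d0 : 0 <= d by exact: mdist_ge0.
have bound u v : 0 <= u -> u <= v -> v <= 1 ->
    mdist x (c u) + mdist (c u) (c v) + mdist (c v) y <= d + e.
  move=> u0 uv v1; rewrite -c0 -c1 -lee_fin.
  by apply: le_trans (ltW lc); exact: curve_length_ge3.
have tau s : exists u, s \in `[0, 1] ->
    [/\ 0 <= u, u <= 1, mdist x (c u) = s * d, s = 0 -> u = 0 & s = 1 -> u = 1].
  have [s01|] := boolP (s \in `[0, 1]); last by exists 0.
  have [->|s0] := eqVneq s 0.
    by exists 0 => _; split => //; rewrite c0 mdistxx mul0r.
  have [->|s1] := eqVneq s 1.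
    by exists 1 => _; split => //; rewrite c1 mul1r.
  have [||u u01 hu] := @IVT R (fun u => mdist x (c u)) 0 1 (s * d) ler01.
  - apply: (@within_continuous_comp _ _ _ _ c (mdist x)) => // z _.
    exact: continuous_mdistl.
  - rewrite c0 c1 mdistxx -/d min_l// max_r//.
    move: s01; rewrite in_itv/= => /andP[s0' s1'].
    by rewrite mulr_ge0//= ler_piMl.
  exists u => _; move: u01; rewrite in_itv/= => /andP[u0 u1].
  by split => // /eqP; rewrite (negbTE s0, negbTE s1).
pose w s := sval (cid (tau s)).
have wP s : s \in `[0, 1] -> [/\ 0 <= w s, w s <= 1, mdist x (c (w s)) = s * d,
    s = 0 -> w s = 0 & s = 1 -> w s = 1].
  by rewrite /w; case: cid.
have I0 : (0 : R) \in `[0, 1] by rewrite in_itv/= lexx ler01.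
have I1 : (1 : R) \in `[0, 1] by rewrite in_itv/= lexx ler01.
exists (c \o w); split => /=.
- by have [_ _ _ -> //] := wP 0 I0.
- by have [_ _ _ _ ->] := wP 1 I1.
move=> s t s01 t01 st.
have [ws0 ws1 ds _ _] := wP s s01; have [wt0 wt1 dt _ _] := wP t t01.
have std : 0 <= (t - s) * d by rewrite mulr_ge0// subr_ge0.
have [wst|/ltW wts] := leP (w s) (w t).
- have := bound _ _ ws0 wst wt1.
  have := metric_triangle x (c (w t)) y; rewrite -/d ds dt; lra.
- have := bound _ _ wt0 wts ws1.
  have := metric_triangle x (c (w s)) y.
  by rewrite -/d ds dt (metric_sym (c (w t))); lra.
Qed.

(** A pointwise limit of almost minimizing curves is minimizing; its continuity
    is a consequence, so that pointwise convergence is enough. *)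
Lemma exists_minimizing_geodesic x y : compact [set: X] -> is_length_space X ->
  exists g, [/\ g 0 = x, g 1 = y & minimizing_geodesic g].
Proof.
move=> cX lX.
have eps_gt0 n : 0 < (n.+1%:R^-1 : R) by rewrite invr_gt0.
pose a n := sval (cid (almost_minimizing_geodesic x y lX (eps_gt0 n))).
have aP n : [/\ a n 0 = x, a n 1 = y &
    forall s t, s \in `[0, 1] -> t \in `[0, 1] -> s <= t ->
      mdist (a n s) (a n t) <= (t - s) * mdist x y + n.+1%:R^-1].
  by rewrite /a; case: cid.
have [U [UU ooU]] := ultraFilterLemma (@eventually_filter).
have lim_a s := ultra_compact_cvg (a ^~ s) cX UU.
pose g s := sval (cid (lim_a s)).
have ag s : a n s @[n --> U] --> g s by rewrite /g; case: cid.
have g0 : g 0 = x.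
  apply: (@cvg_unique _ (@metric_hausdorff R X) (a ^~ 0 @ U)); first exact: ag.
  rewrite (_ : a ^~ 0 = cst x); first exact: cvg_cst.
  by apply/funext => n; have [] := aP n.
have g1 : g 1 = y.
  apply: (@cvg_unique _ (@metric_hausdorff R X) (a ^~ 1 @ U)); first exact: ag.
  rewrite (_ : a ^~ 1 = cst y); first exact: cvg_cst.
  by apply/funext => n; have [] := aP n.
exists g; split => //; apply: lipschitz_minimizing_geodesic => s t s01 t01 st.
rewrite g0 g1.
apply: (@ler_cvg_to _ U _ _ (fun n => mdist (a n s) (a n t))
  (fun n => (t - s) * mdist x y + n.+1%:R^-1)).
- exact: cvg_mdist (ag s) (ag t).
- rewrite -[X in _ --> X]addr0; apply: cvgD; first exact: cvg_cst.
  by apply: cvg_trans (cvg_harmonic); exact: cvg_app.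
- by apply: nearW => n; have [_ _] := aP n; exact.
Qed.

(** Glue at [z] a geodesic from [x] to [z] and one from [z] to [y], run at the
    same speed. *)
Lemma minimizing_geodesic_through x y z (t : R) :
  compact [set: X] -> is_length_space X -> 0 < t -> t < 1 ->
  mdist x z = t * mdist x y -> mdist z y = (1 - t) * mdist x y ->
  exists g, [/\ g 0 = x, g 1 = y, g t = z & minimizing_geodesic g].
Proof.
move=> cX lX t0 t1 xz zy.
have [a [a0 a1 ma]] := exists_minimizing_geodesic x z cX lX.
have [b [b0 b1 mb]] := exists_minimizing_geodesic z y cX lX.
have t10 : 0 < 1 - t by rewrite subr_gt0.
pose g s := if s <= t then a (s / t) else b ((s - t) / (1 - t)).
have g0 : g 0 = x by rewrite /g ltW// mul0r.
have g1 : g 1 = y by rewrite /g leNgt t1/= divff// gt_eqF.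
have gt : g t = z by rewrite /g lexx divff// gt_eqF.
have ga s s' : 0 <= s -> s <= s' -> s' <= t ->
    mdist (g s) (g s') = (s' - s) * mdist x y.
  move=> s0 ss s't; rewrite /g (le_trans ss s't) s't ma ?in_itv/=; last 2 first.
  - by rewrite divr_ge0 ?(ltW t0)//= ler_pdivrMr// mul1r (le_trans ss).
  - by rewrite divr_ge0 ?(ltW t0) ?(le_trans s0)//= ler_pdivrMr// mul1r.
  rewrite a0 a1 xz -mulrBl normrM ler0_norm ?subr_le0// opprB.
  rewrite ger0_norm ?invr_ge0 ?(ltW t0)// mulrA -(mulrA (s' - s)).
  by rewrite mulVf ?mulr1// gt_eqF.
have gb s s' : t <= s -> s <= s' -> s' <= 1 ->
    mdist (g s) (g s') = (s' - s) * mdist x y.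
  move=> s0 ss s't.
  have gE r : t <= r -> g r = b ((r - t) / (1 - t)).
    rewrite le_eqVlt => /predU1P[<-|]; first by rewrite gt subrr mul0r b0.
    by rewrite /g ltNge => /negbTE ->.
  rewrite (gE _ s0) (gE _ (le_trans s0 ss)) mb ?in_itv/=; last 2 first.
  - rewrite divr_ge0 ?subr_ge0 ?(ltW t1)//= ler_pdivrMr// mul1r.
    by rewrite lerB// (le_trans ss).
  - rewrite divr_ge0 ?subr_ge0 ?(ltW t1) ?(le_trans s0)//= ler_pdivrMr// mul1r.
    by rewrite lerB.
  rewrite b0 b1 zy -mulrBl opprB addrA subrK normrM ler0_norm ?subr_le0// opprB.
  rewrite ger0_norm ?invr_ge0 ?(ltW t10)// mulrA -(mulrA (s' - s)).
  by rewrite mulVf ?mulr1// gt_eqF.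
exists g; split => //; apply: lipschitz_minimizing_geodesic => s s'.
rewrite !in_itv/= g0 g1 => /andP[s0 s1] /andP[s'0 s'1] ss.
have [s't|/ltW ts'] := leP s' t; first by rewrite ga.
have [st|/ltW ts] := leP s t; last by rewrite gb.
apply: le_trans (metric_triangle _ (g t) _) _.
by rewrite ga// gb//; lra.
Qed.

End geodesics_in_length_spaces.

(** * Borel sets of a compact metric space and of its square *)

Lemma hausdorff_prod (X Y : topologicalType) :
  hausdorff_space X -> hausdorff_space Y -> hausdorff_space (X * Y)%type.
Proof.
move=> hX hY [x y] [x' y'] clxy; congr (_, _).
- apply: hX => A B xA xB.
  have [[a b] [/= Aa Ba]] := clxy (fst @^-1` A) (fst @^-1` B)
    (@cvg_fst _ _ _ _ _ A xA) (@cvg_fst _ _ _ _ _ B xB).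
  by exists a.
- apply: hY => A B xA xB.
  have [[a b] [/= Aa Ba]] := clxy (snd @^-1` A) (snd @^-1` B)
    (@cvg_snd _ _ _ _ _ A xA) (@cvg_snd _ _ _ _ _ B xB).
  by exists b.
Qed.

Section borel_measurability.

Lemma measurable_open_borel (T : ptopologicalType) (A : set T) :
  open A -> measurable (A : set (borel T)).
Proof. by move=> oA; exact: sub_sigma_algebra. Qed.

Lemma measurable_closed_borel (T : ptopologicalType) (A : set T) :
  closed A -> measurable (A : set (borel T)).
Proof.
move=> cA; rewrite -[A]setCK; apply: measurableC; apply: measurable_open_borel.
exact: closed_openC.
Qed.

(** [X] is second countable, so an open set of [X * X] is a countable union of
    open rectangles. *)
Lemma measurable_open_prod (R : realType) (X : pmetricType R)
    (A : set (X * X)) :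
  compact [set: X] -> open A -> measurable (A : set (borel X * borel X)%type).
Proof.
move=> cX oA.
have [B cB [oB basB]] : @second_countable X.
  exact: (@compact_second_countable R).
pose BB := [set V : set X * set X | [/\ B V.1, B V.2 & V.1 `*` V.2 `<=` A]].
have -> : A = \bigcup_(V in BB) (V.1 `*` V.2).
  apply/seteqP; split => [[x y] Axy|z [V [_ _ VA] Vz]]; last exact: VA.
  move: oA; rewrite openE => /(_ _ Axy)[[P Q]]/= [xP yQ] PQA.
  have [U [BU Ux] UP] := basB x P xP; have [V [BV Vy] VQ] := basB y Q yQ.
  exists (U, V); last by split.
  by split => //= -[u v] [/= Uu Vv]; apply: PQA; split; [exact: UP|exact: VQ].
have /countable_injP[f injf] : countable BB.
  apply: (@sub_countable _ _ _ (B `*` B)); last exact: countableX.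
  by apply: subset_card_le => V [].
have -> : \bigcup_(V in BB) (V.1 `*` V.2) =
    \bigcup_n \bigcup_(V in BB `&` f @^-1` [set n]) (V.1 `*` V.2).
  apply/seteqP; split => [z [V BV Vz]|z [n _ [V [BV _] Vz]]]; last by exists V.
  by exists (f V) => //; exists V.
apply: bigcupT_measurable => n.
have [->|/set0P[V [BV fV]]] := eqVneq (BB `&` f @^-1` [set n]) set0.
  by rewrite bigcup_set0.
have -> : BB `&` f @^-1` [set n] = [set V].
  apply/seteqP; split => [W [BW fW]|_ -> //].
  by apply: injf; rewrite ?inE// fW fV.
rewrite bigcup_set1; have [/oB oV1 /oB oV2 _] := BV.
by apply: measurableX; exact: measurable_open_borel.
Qed.

Lemma measurable_closed_prod (R : realType) (X : pmetricType R)
    (A : set (X * X)) :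
  compact [set: X] -> closed A -> measurable (A : set (borel X * borel X)%type).
Proof.
move=> cX cA; rewrite -[A]setCK; apply: measurableC.
by apply: (measurable_open_prod cX); exact: closed_openC.
Qed.

Lemma measurable_fun_open_preimage (R : realType) d (T : measurableType d)
    (f : T -> R) :
  (forall V : set R, open V -> measurable (f @^-1` V)) ->
  measurable_fun [set: T] f.
Proof.
move=> H; apply: (measurability _ (RGenOpens.measurableE R)).
move=> _ [_ [a [b ->] <-]]; rewrite setTI; apply: H; exact: interval_open.
Qed.

Lemma continuous_measurable_borel (R : realType) (T : ptopologicalType)
    (f : T -> R) : continuous f ->
  measurable_fun [set: borel T] (f : borel T -> R).
Proof.
move=> cf; apply: measurable_fun_open_preimage => V oV.
apply: measurable_open_borel; apply: open_comp => // ? _; apply: cf.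
Qed.

Lemma continuous_borel_measurable (S T : ptopologicalType) (f : S -> T) :
  continuous f -> measurable_fun [set: borel S] (f : borel S -> borel T).
Proof.
move=> cf; apply: (@measurability _ _ (borel S) (borel T) _ _ open) => //.
move=> _ [V oV <-]; rewrite setTI.
apply: measurable_open_borel; apply: open_comp => // ? _; apply: cf.
Qed.

Lemma continuous_measurable_prod (R : realType) (X : pmetricType R)
    (f : X * X -> R) : compact [set: X] -> continuous f ->
  measurable_fun [set: (borel X * borel X)%type] f.
Proof.
move=> cX cf; apply: measurable_fun_open_preimage => V oV.
apply: (measurable_open_prod cX); apply: open_comp => // ? _; apply: cf.
Qed.

End borel_measurability.

(** * The compact space of geodesics and its endpoint map *)

Section geodesic_space.
Context {R : realType} {X : pmetricType R}.
Implicit Types (x y z : X) (g : geodesic X).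

Let clamp (t : R) : R := Num.max 0 (Num.min t 1).

Let clamp01 t : clamp t \in `[0, 1].
Proof.
by rewrite in_itv/= /clamp le_max lexx/= ge_max ler01 ge_min lexx orbT.
Qed.

Let clamp_id t : t \in `[0, 1] -> clamp t = t.
Proof.
by rewrite in_itv/= /clamp => /andP[t0 t1]; rewrite min_l// max_r.
Qed.

Lemma geodesicP g : minimizing_geodesic (ev ^~ g).
Proof. by have /set_mem[] := valP g. Qed.

Lemma mdist_geodesic g (s t : R) : s \in `[0, 1] -> t \in `[0, 1] ->
  mdist (ev s g) (ev t g) = `|s - t| * mdist (ev 0 g) (ev 1 g).
Proof. by move=> s01 t01; exact: geodesicP. Qed.

Let ev_clamp t g : ev t g = ev (clamp t) g.
Proof. by have /set_mem[_ /(_ t)] := valP g. Qed.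

Lemma geodesic_of_curve (c : R -> X) : minimizing_geodesic c ->
  exists g, {in `[0, 1], ev ^~ g =1 c}.
Proof.
move=> mc.
have gc : ((c \o clamp) : {uniform` `[0 : R, 1]%classic -> X}) \in geodesics X.
  rewrite inE; split; last first.
    move=> t; change (c (clamp t) = c (clamp (clamp t))).
    by rewrite (clamp_id (clamp01 t)).
  by apply: eq_minimizing_geodesic mc => t t01 /=; rewrite clamp_id.
by exists (SigSub gc) => t t01; rewrite -[LHS]/(c (clamp t)) clamp_id.
Qed.

Lemma nbhs_geodesic g (A : set (geodesic X)) : nbhs g A ->
  exists2 e, 0 < e &
  forall h, (forall t, t \in `[0, 1] -> mdist (ev t g) (ev t h) < e) -> A h.
Proof.
move=> [_ [[W oW <-] Wg WA]].
have : nbhs (set_val g) W by exact: open_nbhs_nbhs.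
move=> /uniform_nbhs[E [+ EW]].
rewrite -entourage_ballE => -[e /= e0 eE].
exists e => // h gh; apply: WA; apply: EW => t t01.
apply: eE => /=; rewrite ballEmdist/=; apply: gh.
by move: t01.
Qed.

Lemma continuous_ev t : continuous (ev t : geodesic X -> X).
Proof.
move=> g A /nbhs_ballP[e /= e0 eA].
have : nbhs (set_val g) [set h : {uniform` `[0 : R, 1]%classic -> X} |
    forall s, s \in `[0, 1] -> mdist (ev s g) (h s) < e].
  apply/uniform_nbhs; exists [set z | mdist z.1 z.2 < e]; split.
    rewrite -entourage_ballE; exists e => //= z /=.
    by rewrite ballEmdist.
  by move=> h gh s s01 /=; apply: (gh s).
move/(@initial_continuous (geodesics X) _ (@set_val _ (geodesics X)) g).
move=> H; change (nbhs (g : geodesic X) (ev t @^-1` A)).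
apply: (@filterS (geodesics X) (nbhs g) _ _ _ _ H) => h gh.
apply: eA; rewrite ballEmdist/= ev_clamp [in X in mdist _ X]ev_clamp.
exact: gh.
Qed.

Lemma compact_mdist_bounded : compact [set: X] ->
  exists2 D : R, 0 < D & forall x y, mdist x y <= D.
Proof.
move=> cX.
have XX0 : [set: X * X] !=set0 by exists (point, point).
have cXX : compact [set: X * X] by rewrite -setXTT; exact: compact_setX.
have cd : {within [set: X * X], continuous (fun z : X * X => mdist z.1 z.2)}.
  by apply: continuous_subspaceT; exact: continuous_mdist.
have [[x y] _ H] := compact_EVT_max XX0 cXX cd.
exists (mdist x y + 1); first by rewrite ltr_wpDl// mdist_ge0.
by move=> u v; rewrite (le_trans (H (u, v) (mem_set I)))// ?inE// lerDl.
Qed.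

(** Geodesics in a bounded space are uniformly Lipschitz, so a pointwise limit
    of geodesics along an ultrafilter is a uniform one: closeness at a finite
    net of times gives closeness at all times. *)
Lemma compact_geodesic : compact [set: X] -> compact [set: geodesic X].
Proof.
move=> cX; rewrite compact_ultra => U UU _.
have lim_ev t := ultra_compact_cvg (ev t : geodesic X -> X) cX UU.
pose c t := sval (cid (lim_ev t)).
have cP t : ev t g @[g --> U] --> c t by rewrite /c; case: cid.
have mc : minimizing_geodesic c.
  move=> s t s01 t01.
  apply: (@cvg_unique _ (@Rhausdorff R)
    ((fun g => mdist (ev s g) (ev t g)) @ U)).
    exact: cvg_mdist (cP s) (cP t).
  rewrite (_ : (fun _ => _) = fun g => `|s - t| * mdist (ev 0 g) (ev 1 g)).
    by apply: cvgM; [exact: cvg_cst|exact: cvg_mdist (cP 0) (cP 1)].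
  by apply/funext => g; exact: mdist_geodesic.
have [g gc] := geodesic_of_curve mc.
exists g; split => // A /nbhs_geodesic[e e0 eA].
have [D D0 diamX] := compact_mdist_bounded cX.
(* Two times at distance 1 / n are mapped to points at distance below e / 3. *)
pose n := (Num.truncn (D / (e / 3))).+1.
have n0 : 0 < n%:R :> R by rewrite ltr0n.
have Dn : D / n%:R < e / 3.
  rewrite ltr_pdivrMr// mulrC -ltr_pdivrMr ?divr_gt0//.
  exact: truncnS_gt.
have e30 : 0 < e / 3 by rewrite divr_gt0.
have net : \forall h \near U, forall i : 'I_n.+1,
    mdist (ev (i%:R / n%:R) g) (ev (i%:R / n%:R) h) < e / 3.
  apply: filter_forall => i.
  have i01 : i%:R / n%:R \in `[0 : R, 1].
    rewrite in_itv/= divr_ge0//= ler_pdivrMr// mul1r ler_nat.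
    by rewrite -ltnS ltn_ord.
  rewrite (gc _ i01).
  exact: (@metricType_numDomainType.cvgr_dist_lt _ _ _ U _ _ _
    (cP (i%:R / n%:R)) _ e30).
apply: filterS net => h net; apply: eA => t /[dup] t01.
rewrite in_itv/= => /andP[t0 t1].
pose i := Num.truncn (t * n%:R).
have tn0 : 0 <= t * n%:R by rewrite mulr_ge0.
have /andP[i1 i2] : i%:R <= t * n%:R < i.+1%:R by exact: truncn_itv.
have iln : (i < n.+1)%N.
  by rewrite ltnS -(ler_nat R) (le_trans i1)// ler_piMl// ltW.
have := net (Ordinal iln); rewrite /=; set s := _ / _ => gs.
have s01 : s \in `[0, 1].
  by rewrite in_itv/= divr_ge0//= ler_pdivrMr// mul1r ler_nat -ltnS.
have st : `|t - s| <= n%:R^-1.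
  rewrite ger0_norm ?subr_ge0 ?ler_pdivrMr// lerBlDr -[X in X + _]mul1r.
  by rewrite -mulrDl ler_pdivlMr// nat1r ltW.
have speed (k : geodesic X) : mdist (ev t k) (ev s k) < e / 3.
  rewrite (mdist_geodesic k t01 s01).
  by rewrite (le_lt_trans _ Dn)// mulrC ler_pM// ?mdist_ge0.
have := metric_triangle (ev t g) (ev s g) (ev t h).
have := metric_triangle (ev s g) (ev s h) (ev t h).
have := speed g; have := speed h; rewrite (metric_sym (ev s h)); move: gs; lra.
Qed.

Lemma continuous_endpoints : continuous (endpoints : geodesic X -> X * X).
Proof.
move=> g V [[A B]/= [gA gB] ABV].
change (nbhs g (endpoints @^-1` V)).
have gAB : nbhs g ((ev 0 @^-1` A) `&` (ev 1 @^-1` B)).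
  by apply: filterI; [exact: (continuous_ev gA)|exact: (continuous_ev gB)].
by apply: filterS gAB => h [hA hB]; apply: ABV; split.
Qed.

Lemma closed_image_endpoints (F : set (geodesic X)) : compact [set: X] ->
  closed F -> closed (endpoints @` F).
Proof.
move=> cX cF; apply: compact_closed.
  by apply: hausdorff_prod; exact: metric_hausdorff.
apply: continuous_compact.
  by apply: continuous_subspaceT; exact: continuous_endpoints.
exact: (subclosed_compact cF (compact_geodesic cX)).
Qed.

(** [z] lies at time [t] on some geodesic from [x] to [y], and [g] is the only
    candidate. *)
Lemma unique_geodesic_intermediate x y z (t : R) g :
  compact [set: X] -> is_length_space X -> 0 < t -> t < 1 ->
  (forall h, endpoints h = (x, y) -> g = h) ->
  mdist x z = t * mdist x y -> mdist z y = (1 - t) * mdist x y -> z = ev t g.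
Proof.
move=> cX lX t0 t1 ug xz zy.
have [c [c0 c1 ct mc]] := minimizing_geodesic_through cX lX t0 t1 xz zy.
have [h hc] := geodesic_of_curve mc.
rewrite (ug h) ?hc ?in_itv/= ?ltW//.
by rewrite /endpoints !hc ?in_itv/= ?lexx ?ler01// c0 c1.
Qed.

(** Within [G], the preimage under [S] of a closed set [F] of geodesics is the
    set of endpoints of members of [F], which is compact because [F] is. Outside
    [G] the selector is constant. *)
Lemma measurable_geodesic_selector (G : set (borel X * borel X)%type) :
  compact [set: X] -> measurable G ->
  (forall p, G p -> exists! g : geodesic X, endpoints g = p) ->
  exists S : borel X * borel X -> borel (geodesic X),
    measurable_fun [set: (borel X * borel X)%type] S /\
    forall p, G p -> endpoints (S p) = p /\
      forall h : geodesic X, endpoints h = p -> S p = h.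
Proof.
move=> cX mG uG.
have sel p : exists g : geodesic X, if pselect (G p) then endpoints g = p /\
      forall h : geodesic X, endpoints h = p -> g = h else g = point.
  case: pselect => [Gp|nGp]; last by exists point.
  by have [g [? ?]] := uG _ Gp; exists g.
pose S p := sval (cid (sel p)).
have SP p : G p -> endpoints (S p) = p /\
      forall h : geodesic X, endpoints h = p -> S p = h.
  by rewrite /S; case: cid => /= g; case: pselect.
have SN p : ~ G p -> S p = point.
  by rewrite /S; case: cid => /= g; case: pselect.
exists S; split => //.
apply: (@measurability _ _ _ (borel (geodesic X)) _ _ open) => //.
move=> _ [V oV <-]; rewrite setTI -[X in measurable X]setCK preimage_setC.
apply: measurableC; set F := ~` V.
have -> : S @^-1` F = (G `&` endpoints @` F) `|` (~` G `&` [set _ | F point]).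
  apply/seteqP; split => [p Fz|p [[Gz [g Fg gz]]|[Gz Fz]]] /=.
  - have [Gz|Gz] := pselect (G p); [left|right]; split => //=.
      by exists (S p) => //; have [] := SP p Gz.
    by rewrite -(SN p).
  - by have [_ /(_ g gz) ->] := SP p Gz.
  - by rewrite SN.
apply: measurableU; apply: measurableI => //.
- apply: (measurable_closed_prod cX); apply: closed_image_endpoints => //.
  exact: open_closedC.
- exact: measurableC.
- have [Fp|Fp] := pselect (F point).
    by rewrite (_ : [set _ | _] = setT)//; apply/seteqP; split.
  by rewrite (_ : [set _ | _] = set0)//; apply/seteqP; split.
Qed.

End geodesic_space.

(** * Regularity of finite Borel measures *)

Section closed_regularity.
Context {R : realType} {X : pmetricType R}.
Local Open Scope ereal_scope.

Definition closed_inner_regular (m : set (borel X) -> \bar R)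
    (A : set (borel X)) :=
  forall e : R, (0 < e)%R -> exists F : set (borel X),
    [/\ closed (F : set X), F `<=` A & m (A `\` F) <= e%:E].

Lemma open_closed_exhaustion (A : set X) : open A ->
  exists F : nat -> set X, [/\ forall n, closed (F n), nondecreasing_seq F &
    \bigcup_n F n = A].
Proof.
move=> oA.
exists (fun n =>
  [set x : X | forall y, ~ A y -> (n.+1%:R^-1 <= mdist x y)%R]); split.
- move=> n.
  rewrite (_ : [set _ | _] = \bigcap_(y in ~` A)
      (mdist^~ y @^-1` [set r | (n.+1%:R^-1 <= r)%R])).
    apply: closed_bigI => y _; apply: preimage_closed.
      by move=> z _; exact: continuous_mdistr.
    exact: closed_ge.
  by apply/seteqP; split => x xA y; exact: xA.
- move=> m n mn; apply/subsetPset => x xA y Ay.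
  by rewrite (le_trans _ (xA y Ay))// lef_pV2 ?posrE// ler_nat.
- apply/seteqP; split => [x [n _ xA]|x Ax].
    apply: contrapT => nAx; have := xA x nAx.
    by rewrite mdistxx leNgt invr_gt0 ltr0n.
  have : nbhs x A by exact: open_nbhs_nbhs.
  move=> /nbhs_ballP[e /= e0 eA].
  have [n ne] : exists n, (n.+1%:R^-1 < e)%R.
    by have [n] := ltr_add_invr e0; rewrite add0r; exists n.
  exists n => // y nAy; rewrite leNgt; apply/negP => xy; apply: nAy.
  by apply: eA; rewrite ballEmdist/= (lt_trans xy).
Qed.

Section regularity.
Variable m : {finite_measure set (borel X) -> \bar R}.

Let mfin (A : set (borel X)) : measurable A -> m A \is a fin_num.
Proof. exact: fin_num_measure. Qed.

Let inner_nondecreasing (A : nat -> set (borel X)) :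
  (forall n, measurable (A n)) -> nondecreasing_seq A ->
  (forall n, closed_inner_regular m (A n)) ->
  closed_inner_regular m (\bigcup_n A n).
Proof.
move=> mA ndA iA e e0.
have mUA : measurable (\bigcup_n A n) by exact: bigcupT_measurable.
have : m \o (fun n => (\bigcup_n A n) `\` A n) @ \oo -->
    m (\bigcap_n ((\bigcup_n A n) `\` A n)).
  apply: nonincreasing_cvg_mu.
  - rewrite ltey_eq mfin//; exact: measurableD.
  - by move=> n; exact: measurableD.
  - by apply: bigcapT_measurable => n; exact: measurableD.
  - move=> n k nk; apply/subsetPset => x [UAx nAx]; split => // Anx.
    by apply: nAx; move/ndA : nk => /subsetPset; exact.
rewrite (_ : \bigcap_n _ = set0); last first.
  apply/seteqP; split => // x xA.
  have [[n _ Anx] _] := xA 0%N I.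
  by have [_] := xA n I; exact.
rewrite measure0 => /fine_cvgP[_ /cvgr_dist_le].
move=> /(_ (e / 2)%R (divr_gt0 e0 (ltr0Sn _ 1)))[n _ /(_ n (leqnn n))] /=.
have mD : measurable ((\bigcup_n A n) `\` A n) by exact: measurableD.
rewrite sub0r normrN ger0_norm ?fine_ge0// -lee_fin fineK ?mfin// => mn.
have [F [cF FA mF]] := iA n (e / 2)%R (divr_gt0 e0 (ltr0Sn _ 1)).
exists F; split => //.
  by apply: subset_trans FA _; exact: bigcup_sup.
have mcF : measurable F by exact: measurable_closed_borel.
apply: (@le_trans _ _ (m (((\bigcup_n A n) `\` A n) `|` (A n `\` F)))).
  apply: le_measure; rewrite ?inE.
  - exact: measurableD.
  - by apply: measurableU => //; exact: measurableD.
  - move=> x [UAx Fx]; have [Anx|Anx] := pselect (A n x); [by right|by left].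
apply: le_trans (measureU2 _ _ _) _ => //; first exact: measurableD.
by rewrite (splitr e) EFinD leeD.
Qed.

Let inner_bigcap (A : nat -> set (borel X)) :
  (forall n, measurable (A n)) ->
  (forall n, closed_inner_regular m (A n)) ->
  closed_inner_regular m (\bigcap_n A n).
Proof.
move=> mA iA e e0.
have en n : (0 < e / (2 ^ n.+1)%:R)%R by rewrite divr_gt0// ltr0n expn_gt0.
pose F n := sval (cid (iA n _ (en n))).
have FP n : [/\ closed (F n : set X), F n `<=` A n &
    m (A n `\` F n) <= (e / (2 ^ n.+1)%:R)%:E].
  by rewrite /F; case: cid.
have mF n : measurable (F n).
  by have [+ _ _] := FP n => /measurable_closed_borel.
exists (\bigcap_n F n); split.
- by apply: closed_bigI => n _; have [] := FP n.
- by move=> x xF n _; have [_ FA _] := FP n; apply: FA; exact: xF.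
apply: le_trans (epsilon_trick0 xpredT (ltW e0)).
apply: (@le_trans _ _ (\sum_(n <oo) m (A n `\` F n))).
  apply: measure_sigma_subadditive.
  - by move=> n; exact: measurableD.
  - by apply: measurableD; exact: bigcapT_measurable.
  - move=> x [xA /existsNP[n /not_implyP[_ nFx]]]; exists n => //; split => //.
    exact: xA.
apply: lee_nneseries => [n _ _|n _]; first exact: measure_ge0.
by have [] := FP n.
Qed.

Let inner_setU (A B : set (borel X)) : measurable A -> measurable B ->
  closed_inner_regular m A -> closed_inner_regular m B ->
  closed_inner_regular m (A `|` B).
Proof.
move=> mA mB iA iB e e0.
have [F [cF FA mF]] := iA (e / 2)%R (divr_gt0 e0 (ltr0Sn _ 1)).
have [G [cG GB mG]] := iB (e / 2)%R (divr_gt0 e0 (ltr0Sn _ 1)).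
have mcF : measurable F by exact: measurable_closed_borel.
have mcG : measurable G by exact: measurable_closed_borel.
exists (F `|` G); split; [exact: closedU|exact: setUSS|].
apply: (@le_trans _ _ (m ((A `\` F) `|` (B `\` G)))).
  apply: le_measure; rewrite ?inE.
  - by apply: measurableD; exact: measurableU.
  - by apply: measurableU; exact: measurableD.
  - by move=> x [[Ax|Bx] /not_orP[nF nG]]; [left|right].
apply: le_trans (measureU2 _ _ _) _; try exact: measurableD.
by rewrite (splitr e) EFinD leeD.
Qed.

(** The sets which are approximated by closed sets from inside, and whose
    complements are too, form a sigma-algebra containing the open sets. *)
Lemma borel_closed_inner_regular (A : set (borel X)) : measurable A ->
  closed_inner_regular m A.
Proof.
have closed_inner (F : set (borel X)) :
    closed (F : set X) -> closed_inner_regular m F.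
  by move=> cF e e0; exists F; split => //; rewrite setDv measure0 lee_fin ltW.
pose G : set (set (borel X)) := [set A | [/\ measurable A,
  closed_inner_regular m A & closed_inner_regular m (~` A)]].
suff : <<s @open X >> `<=` G by move=> /[apply] -[].
apply: smallest_sub; first split.
- split => //; first exact: closed_inner (@closed0 X).
  by rewrite setC0; exact: closed_inner (@closedT X).
- move=> B0 [+ + +]; pose B : set (borel X) := B0.
  rewrite -[B0]/B => mB iB iBC; rewrite setTD.
  split => //; first exact: measurableC.
  by rewrite setCK.
- move=> B0; pose B : (set (borel X))^nat := B0; move=> GB; rewrite -/B.
  have mB n : measurable (B n) by have [] := GB n.
  split; first exact: bigcupT_measurable.
  + rewrite -bigcup_bigsetU_bigcup.
    have mC n : measurable (\big[setU/set0]_(i < n.+1) B i).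
      by apply: bigsetU_measurable => i _.
    apply: inner_nondecreasing => //.
      by move=> i j ij; apply/subsetPset; exact: subset_bigsetU.
    elim => [|n ih].
      by rewrite big_ord1; have [] := GB 0%N.
    rewrite big_ord_recr; apply: (inner_setU (mC n) (mB n.+1)) => //.
    by have [] := GB n.+1.
  + rewrite setC_bigcup; apply: inner_bigcap => n; first exact: measurableC.
    by have [] := GB n.
- move=> O oO; split; first exact: measurable_open_borel.
  + have [F [cF ndF <-]] := open_closed_exhaustion oO.
    apply: inner_nondecreasing => // n; first exact: measurable_closed_borel.
    exact: closed_inner.
  + by apply: closed_inner; exact: open_closedC.
Qed.

Lemma measure_le_on_closed (m' : {measure set (borel X) -> \bar R}) (c : R) :
  (0 <= c)%R ->
  (forall F : set (borel X), closed (F : set X) -> m F <= c%:E * m' F) ->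
  forall A, measurable A -> m A <= c%:E * m' A.
Proof.
move=> c0 mm A mA; apply/lee_addgt0Pr => e e0.
have [F [cF FA mF]] := borel_closed_inner_regular mA e0.
have mcF : measurable F by exact: measurable_closed_borel.
apply: (@le_trans _ _ (m (F `|` (A `\` F)))); first by rewrite setDUK.
apply: le_trans (measureU2 _ _ _) _ => //; first exact: measurableD.
apply: leeD => //; apply: le_trans (mm _ cF) _.
by apply: lee_wpmul2l; [rewrite lee_fin|apply: le_measure; rewrite ?inE].
Qed.

End regularity.
End closed_regularity.

(** * Wasserstein geodesics issued from a Dirac mass *)

Section coupling_concentration.
Context {R : realType} {X : pmetricType R}.
Hypothesis cX : compact [set: X].
Local Open Scope ereal_scope.
Implicit Types (mu : probability (borel X) R) (x y : X).

Let cost (pi : probability (borel X * borel X)%type R) :=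
  \int[pi]_z (mdist (z.1 : X) (z.2 : X) ^+ 2)%:E.

Let inf_cost mu0 mu1 := ereal_inf [set cost pi | pi in coupling mu0 mu1].

Lemma coupling_nonempty mu0 mu1 : exists pi, coupling mu0 mu1 pi.
Proof.
exists (mu0 \x mu1 : probability (borel X * borel X)%type R).
split => A mA; rewrite /pushforward.
- rewrite (_ : fst @^-1` A = A `*` [set: borel X]); last first.
    by apply/seteqP; split => [z|z []].
  by rewrite [LHS]product_measure1E// [X in _ * X]probability_setT mule1.
- rewrite (_ : snd @^-1` A = [set: borel X] `*` A); last first.
    by apply/seteqP; split => [z|z []].
  by rewrite [LHS]product_measure1E// [X in X * _]probability_setT mul1e.
Qed.

Let msq (f : X * X -> R) : continuous f ->
  measurable_fun [set: (borel X * borel X)%type] (fun z => (f z ^+ 2)%:E).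
Proof.
move=> cf; apply/measurable_EFinP; apply: measurable_funX.
exact: (continuous_measurable_prod cX cf).
Qed.

Let msq1 x : measurable_fun [set: borel X] (fun y => (mdist x (y : X) ^+ 2)%:E).
Proof.
apply/measurable_EFinP; apply: measurable_funX.
exact: (@continuous_measurable_borel R X (mdist x) (@continuous_mdistl _ _ x)).
Qed.

Let sq_ge0 (r : R) : 0 <= (r ^+ 2)%:E.
Proof. by rewrite lee_fin sqr_ge0. Qed.

Lemma integral_coupling_fst mu0 mu1 pi (f : borel X -> \bar R) :
  coupling mu0 mu1 pi -> measurable_fun [set: borel X] f ->
  (forall x, 0 <= f x) ->
  \int[pi]_z f z.1 = \int[mu0]_x f x.
Proof.
move=> [c1 _] mf f0.
rewrite -(@eq_measure_integral _ _ _ _ _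
  (pushforward pi (fst : borel X * borel X -> borel X)) f); last first.
  by move=> A mA _; exact: c1.
by rewrite ge0_integral_pushforward.
Qed.

Lemma integral_coupling_snd mu0 mu1 pi (f : borel X -> \bar R) :
  coupling mu0 mu1 pi -> measurable_fun [set: borel X] f ->
  (forall x, 0 <= f x) ->
  \int[pi]_z f z.2 = \int[mu1]_x f x.
Proof.
move=> [_ c2] mf f0.
rewrite -(@eq_measure_integral _ _ _ _ _
  (pushforward pi (snd : borel X * borel X -> borel X)) f); last first.
  by move=> A mA _; exact: c2.
by rewrite ge0_integral_pushforward.
Qed.

Lemma cost_dirac_coupling x0 mu0 mu1 pi :
  measure_eq mu0 (dirac (x0 : borel X)) ->
  coupling mu0 mu1 pi -> cost pi = \int[mu1]_y (mdist x0 (y : X) ^+ 2)%:E.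
Proof.
move=> mu0E c; have [c1 _] := c.
rewrite -(integral_coupling_snd c)//.
apply: ge0_ae_eq_integral => //.
- by apply: msq; exact: continuous_mdist.
- apply: (msq (f := fun z => mdist x0 z.2)).
  by move=> z; apply: cvg_mdist; [exact: cvg_cst|exact: cvg_snd].
have mx0 : measurable ([set x0] : set (borel X)).
  apply: measurable_closed_borel; apply: accessible_closed_set1.
  by apply: hausdorff_accessible; exact: metric_hausdorff.
exists (fst @^-1` (~` [set x0])); split.
- rewrite -[X in measurable X]setTI; apply: measurable_fst => //.
  exact: measurableC.
- rewrite [LHS](c1 (~` [set x0])); last exact: measurableC.
  rewrite mu0E; last exact: measurableC.
  by rewrite diracE memNset//= => /(_ erefl).
- move=> [z y] /= H zx0; apply: H => _.
  by rewrite zx0.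
Qed.

Lemma integral_dist_fin x0 mu1 : exists2 r : R, (0 <= r)%R &
  \int[mu1]_y (mdist x0 (y : X) ^+ 2)%:E = r%:E.
Proof.
have [D D0 HD] := compact_mdist_bounded cX.
have I0 : 0 <= \int[mu1]_y (mdist x0 (y : X) ^+ 2)%:E.
  by apply: integral_ge0.
have Ioo : \int[mu1]_y (mdist x0 (y : X) ^+ 2)%:E <= (D ^+ 2)%:E.
  apply: (@le_trans _ _ (\int[mu1]_y (cst (D ^+ 2)%:E y))).
    apply: ge0_le_integral => // y _.
    by rewrite lee_fin lerXn2r ?nnegrE ?mdist_ge0 ?(ltW D0).
  by rewrite integral_cst// [X in _ * X]probability_setT mule1.
exists (fine (\int[mu1]_y (mdist x0 (y : X) ^+ 2)%:E)); first exact: fine_ge0.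
by rewrite fineK// ge0_fin_numE// (le_lt_trans Ioo)// ltry.
Qed.

Lemma inf_cost_dirac x0 mu0 mu1 : measure_eq mu0 (dirac (x0 : borel X)) ->
  inf_cost mu0 mu1 = \int[mu1]_y (mdist x0 (y : X) ^+ 2)%:E.
Proof.
move=> mu0E; rewrite /inf_cost (_ : [set cost pi | pi in _] =
  [set \int[mu1]_y (mdist x0 (y : X) ^+ 2)%:E]); first by rewrite ereal_inf1.
apply/seteqP; split => [_ [pi c <-]|_ ->] /=.
  exact: cost_dirac_coupling c.
have [pi c] := coupling_nonempty mu0 mu1.
by exists pi => //; exact: cost_dirac_coupling c.
Qed.

Lemma inf_cost_ge0 mu0 mu1 : 0 <= inf_cost mu0 mu1.
Proof.
apply: le_ereal_inf_tmp => _ [pi _ <-]; exact: integral_ge0.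
Qed.

Lemma inf_cost_W2 mu0 mu1 (r : R) : (0 <= r)%R -> W2 mu0 mu1 = r%:E ->
  inf_cost mu0 mu1 = (r ^+ 2)%:E.
Proof.
have := inf_cost_ge0 mu0 mu1.
rewrite /W2 -/(inf_cost mu0 mu1); case: (inf_cost mu0 mu1) => [s||]//=.
- rewrite lee_fin => s0 r0 [<-]; rewrite powR12_sqrt// sqr_sqrtr//.
- by move=> _ _; rewrite invr_eq0 pnatr_eq0.
Qed.

Lemma W2_dirac x0 mu0 mu1 (r : R) : measure_eq mu0 (dirac (x0 : borel X)) ->
  (0 <= r)%R -> \int[mu1]_y (mdist x0 (y : X) ^+ 2)%:E = r%:E ->
  W2 mu0 mu1 = (Num.sqrt r)%:E.
Proof.
move=> mu0E r0 rE; rewrite /W2 -/(inf_cost mu0 mu1) (inf_cost_dirac _ mu0E) rE.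
by rewrite poweR_EFin powR12_sqrt.
Qed.

(** All couplings with a Dirac mass have the same cost, so the geodesic
    equations for [W2] become equations between second moments about [x0]; only
    the cost between [mu t] and [mu 1] remains an infimum. *)
Lemma wasserstein_geodesic_from_dirac (mu : R -> probability (borel X) R) x0 t :
  wasserstein_geodesic mu -> measure_eq (mu 0%R) (dirac (x0 : borel X)) ->
  t \in `[0%R, 1%R] -> exists r : R,
  [/\ \int[mu 1%R]_y (mdist x0 (y : X) ^+ 2)%:E = r%:E,
      \int[mu t]_y (mdist x0 (y : X) ^+ 2)%:E = (t ^+ 2 * r)%:E &
      inf_cost (mu t) (mu 1%R) = ((1 - t) ^+ 2 * r)%:E].
Proof.
move=> gmu mu0E t01.
have [r r0 rE] := integral_dist_fin x0 (mu 1%R).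
have W01 := W2_dirac mu0E r0 rE.
have I0 : 0%R \in `[(0 : R)%R, 1%R] by rewrite in_itv/= lexx ler01.
have I1 : 1%R \in `[(0 : R)%R, 1%R] by rewrite in_itv/= lexx ler01.
have := t01; rewrite in_itv/= => /andP[t0 t1].
exists r; split => //.
- rewrite -(inf_cost_dirac _ mu0E) (@inf_cost_W2 _ _ (t * Num.sqrt r)).
  + by rewrite exprMn sqr_sqrtr.
  + by rewrite mulr_ge0// sqrtr_ge0.
  + by rewrite gmu// W01 sub0r normrN ger0_norm.
- rewrite (@inf_cost_W2 _ _ ((1 - t) * Num.sqrt r)).
  + by rewrite exprMn sqr_sqrtr.
  + by rewrite mulr_ge0// ?sqrtr_ge0// subr_ge0.
  + by rewrite gmu// W01 distrC ger0_norm// subr_ge0.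
Qed.

Let defect (x0 : X) (t : R) (z y : X) : R :=
  (mdist x0 z ^+ 2 / t + mdist z y ^+ 2 / (1 - t) - mdist x0 y ^+ 2)%R.

(** The defect in [(a + b)^2 <= a^2 / t + b^2 / (1 - t)] is a square; it
    vanishes only if [a] and [b] are in the ratio [t : 1 - t]. *)
Let sqrD_split (a b t : R) : (0 < t -> t < 1 ->
  a ^+ 2 / t + b ^+ 2 / (1 - t) =
  (a + b) ^+ 2 + (a * (1 - t) - b * t) ^+ 2 / (t * (1 - t)))%R.
Proof. by move=> t0 t1; field; rewrite !gt_eqF// subr_gt0. Qed.

Let defect_ge0 x0 t z y : (0 < t -> t < 1 -> 0 <= defect x0 t z y)%R.
Proof.
move=> t0 t1; rewrite /defect subr_ge0 sqrD_split//.
rewrite (@le_trans _ _ ((mdist x0 z + mdist z y) ^+ 2)%R)//.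
  by rewrite lerXn2r// ?nnegrE ?addr_ge0 ?mdist_ge0// metric_triangle.
by rewrite lerDl divr_ge0 ?sqr_ge0// mulr_ge0 ?subr_ge0// ltW.
Qed.

Lemma intermediate_of_defect (a b D t : R) : (0 < t -> t < 1 -> 0 <= D ->
  D <= a + b -> a ^+ 2 / t + b ^+ 2 / (1 - t) - D ^+ 2 <= 0 ->
  a = t * D /\ b = (1 - t) * D)%R.
Proof.
move=> t0 t1 D0 Dab H.
have t10 : (0 < 1 - t)%R by rewrite subr_gt0.
have D2 : (D ^+ 2 <= (a + b) ^+ 2)%R.
  by rewrite lerXn2r// nnegrE// (le_trans D0).
have E := sqrD_split a b t0 t1.
have sq0 : (0 <= (a * (1 - t) - b * t) ^+ 2 / (t * (1 - t)))%R.
  by rewrite divr_ge0 ?sqr_ge0// mulr_ge0// ltW.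
have /eqP : ((a * (1 - t) - b * t) ^+ 2 / (t * (1 - t)) = 0)%R by lra.
have tt : (t * (1 - t) != 0)%R by rewrite mulf_neq0// gt_eqF.
rewrite mulf_eq0 invr_eq0 (negbTE tt) orbF sqrf_eq0 => /eqP ab.
have /eqP : (D ^+ 2 = (a + b) ^+ 2)%R by lra.
rewrite eqrXn2// ?(le_trans D0)// => /eqP ->.
by split; lra.
Qed.

Lemma continuous_defect x0 t :
  continuous (fun w : X * X => defect x0 t w.1 w.2).
Proof.
have cdist (f g : X * X -> X) : continuous f -> continuous g ->
    continuous (fun w => mdist (f w) (g w) ^+ 2)%R.
  move=> cf cg w; apply: (@continuous_comp _ _ _ (fun w => mdist (f w) (g w))
    (fun r : R => (r ^+ 2)%R)); last exact: exprn_continuous.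
  by apply: cvg_mdist; [exact: cf|exact: cg].
have cfst : continuous (fst : X * X -> X) by move=> w; exact: cvg_fst.
have csnd : continuous (snd : X * X -> X) by move=> w; exact: cvg_snd.
have ccst : continuous (cst x0 : X * X -> X) by move=> w; exact: cvg_cst.
move=> w; apply: cvgB; last exact: (cdist _ _ ccst csnd).
apply: cvgD; apply: cvgM; try exact: cvg_cst.
  exact: (cdist _ _ ccst cfst).
exact: (cdist _ _ cfst csnd).
Qed.

(** The mean of the defect against a nearly optimal coupling of [mu t] and
    [mu 1] is small, by [wasserstein_geodesic_from_dirac]. On the other hand, if
    for almost every [y] no intermediate point between [x0] and [y] lies in
    [V], then by compactness of [V] the defect at [(z, y)] is bounded below for
    all [z] in [V], uniformly in [y] outside a closed set [K] of small measure.
    Hence the coupling gives little mass to [V * ~` K], and to [V * K] too. *)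
Lemma wasserstein_geodesic_avoids_closed (mu : R -> probability (borel X) R)
    x0 (t : R) (V M : set (borel X)) :
  wasserstein_geodesic mu -> measure_eq (mu 0%R) (dirac (x0 : borel X)) ->
  (0 < t)%R -> (t < 1)%R -> closed (V : set X) ->
  measurable M -> mu 1%R M = 0 ->
  (forall y z : X, ~ M y -> V z ->
    mdist x0 z = (t * mdist x0 y)%R -> mdist z y = ((1 - t) * mdist x0 y)%R ->
    False) ->
  mu t V = 0.
Proof.
move=> gmu mu0E t0 t1 cV mM M0 noint.
have t10 : (0 < 1 - t)%R by rewrite subr_gt0.
pose del k : R := (k.+1%:R^-1)%R.
have del0 k : (0 < del k)%R by rewrite invr_gt0.
pose K k : set (borel X) := snd @` ((V `*` [set: X]) `&`
  [set w : X * X | (defect x0 t w.1 w.2 <= del k)%R]).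
have cK k : closed (K k : set X).
  apply: compact_closed; first exact: metric_hausdorff.
  apply: continuous_compact.
    by apply: continuous_subspaceT => w; exact: cvg_snd.
  have cXX : compact [set: X * X] by rewrite -setXTT; exact: compact_setX.
  apply: (subclosed_compact _ cXX) => //; apply: closedI.
    rewrite (_ : V `*` _ = fst @^-1` V); last first.
      by apply/seteqP; split => [w []|w].
    by apply: preimage_closed => // w _; exact: cvg_fst.
  apply: (@preimage_closed _ R (fun w : X * X => defect x0 t w.1 w.2)
      [set s : R | (s <= del k)%R]) => //.
    by move=> w _; exact: continuous_defect.
have mK k : measurable (K k) by exact: measurable_closed_borel.
have capK : mu 1%R (\bigcap_k K k) = 0.
  apply: (@subset_measure0 _ _ _ _ _ M) => //; first exact: bigcapT_measurable.
  move=> y Ky; apply: contrapT => My.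
  have cVy : compact V by exact: (subclosed_compact cV cX).
  have V0 : V !=set0 by have [[z y'] [[Vz _] _] _] := Ky 0%N I; exists z.
  have [|z /set_mem Vz zmin] :=
      @compact_EVT_min X R (fun z => defect x0 t z y) V V0 cVy.
    apply: continuous_subspaceT => z.
    apply: (@continuous_comp _ _ _ (fun z => (z, y))
      (fun w : X * X => defect x0 t w.1 w.2)).
      by apply: cvg_pair; [exact: cvg_id|exact: cvg_cst].
    exact: continuous_defect.
  have : (defect x0 t z y <= 0)%R.
    apply/ler_addgt0Pr => e e0.
    have [k] := ltr_add_invr e0; rewrite !add0r => ke.
    apply: le_trans (ltW ke).
    have [[z' y'] [[Vz' _] /= H] /= yy] := Ky k I.
    by rewrite -yy; apply: le_trans H; rewrite yy; apply: zmin; rewrite inE.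
  move/(intermediate_of_defect t0 t1 (mdist_ge0 _ _) (metric_triangle _ _ _)).
  by case; exact: noint.
have K0 : (mu 1%R \o K) @ \oo --> 0.
  rewrite -capK; apply: nonincreasing_cvg_mu => //.
  - by rewrite ltey_eq fin_num_measure.
  - exact: bigcapT_measurable.
  - move=> m n mn; apply/subsetPset => y [w [Vw /= Kw] wy]; exists w => //.
    split => //; apply: le_trans Kw _.
    by rewrite lef_pV2 ?posrE// ler_nat.
have mV : measurable V by exact: measurable_closed_borel.
have t01 : t \in `[0%R, 1%R] by rewrite in_itv/= !ltW.
have [r [r1 rt rI]] := wasserstein_geodesic_from_dirac gmu mu0E t01.
apply/eqP; rewrite eq_le measure_ge0 andbT; apply/lee_addgt0Pr => e e0.
rewrite add0e.
have e20 : (0 < e / 2)%R by rewrite divr_gt0.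
have [k mKk] : exists k, mu 1%R (K k) <= (e / 2)%:E.
  move: K0 => /fine_cvgP[_ /cvgr_dist_le /(_ _ e20)[k _ /(_ k (leqnn k))]] /=.
  rewrite sub0r normrN ger0_norm ?fine_ge0// -lee_fin fineK; last first.
    exact: fin_num_measure.
  by exists k.
(* The defect weighs [V * ~` K] by [del k], and [mdist z y ^+ 2] enters it with
   the factor [(1 - t)^-1]: this excess of cost leaves mass [e / 2]. *)
pose eps : R := (e / 2 * del k * (1 - t))%R.
have eps0 : (0 < eps)%R by rewrite !mulr_gt0.
have [_ [pi c <-] cpi] : exists2 l,
    [set cost pi | pi in coupling (mu t) (mu 1%R)] l
    & l < ((1 - t) ^+ 2 * r + eps)%:E.
  by apply: ereal_inf_lt; rewrite -/(inf_cost _ _) rI lte_fin ltrDl.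
have [c1 c2] := c.
have mC1 : measurable (fst @^-1` V : set (borel X * borel X)).
  by rewrite -[X in measurable X]setTI; exact: measurable_fst.
have mC2 : measurable (snd @^-1` (K k) : set (borel X * borel X)).
  by rewrite -[X in measurable X]setTI; exact: measurable_snd.
pose A : set (borel X * borel X) := (fst @^-1` V) `\` (snd @^-1` (K k)).
have mA : measurable A by exact: measurableD.
have fA : pi A \is a fin_num by exact: fin_num_measure.
have key : pi A <= (e / 2)%:E.
  have mint : measurable_fun [set: (borel X * borel X)%type]
      (fun w => (mdist x0 (w.1 : X) ^+ 2)%:E).
    apply: (msq (f := fun w => mdist x0 w.1)) => w.
    by apply: cvg_mdist; [exact: cvg_cst|exact: cvg_fst].
  have mint1 : measurable_fun [set: (borel X * borel X)%type]
      (fun w => (mdist x0 (w.2 : X) ^+ 2)%:E).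
    apply: (msq (f := fun w => mdist x0 w.2)) => w.
    by apply: cvg_mdist; [exact: cvg_cst|exact: cvg_snd].
  have mint2 : measurable_fun [set: (borel X * borel X)%type]
      (fun w => (mdist (w.1 : X) (w.2 : X) ^+ 2)%:E).
    by apply: msq; exact: continuous_mdist.
  (* The bound of the defect from below, in a form without subtraction. *)
  have : \int[pi]_w ((mdist x0 (w.2 : X) ^+ 2)%:E + (del k)%:E * (\1_A w)%:E) <=
      \int[pi]_w ((t^-1)%:E * (mdist x0 (w.1 : X) ^+ 2)%:E +
                  ((1 - t)^-1)%:E * (mdist (w.1 : X) (w.2 : X) ^+ 2)%:E).
    apply: ge0_le_integral => //.
    - by move=> w _; rewrite adde_ge0// mule_ge0 ?lee_fin// ltW.
    - apply: emeasurable_funD => //; apply: measurable_funeM.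
      exact/measurable_EFinP/measurable_indic.
    - by apply: emeasurable_funD; exact: measurable_funeM.
    - move=> w _; rewrite -!EFinM -!EFinD lee_fin indicE.
      have [|_] := boolP (w \in A).
        rewrite inE => -[/= Vw Kw].
        rewrite mulr1 addrC -lerBrDr mulrC (mulrC (1 - t)^-1)%R.
        rewrite leNgt; apply/negP => dw; apply: Kw.
        by exists w => //; split => //=; exact: ltW.
      rewrite mulr0 addr0.
      by rewrite -subr_ge0 mulrC (mulrC (1 - t)^-1)%R; exact: defect_ge0.
  rewrite ge0_integralD//=; last 2 first.
  - by move=> w _; rewrite mule_ge0// lee_fin ltW.
  - by apply: measurable_funeM; exact/measurable_EFinP/measurable_indic.
  rewrite ge0_integralD//=; last 4 first.
  - by move=> w _; rewrite mule_ge0// lee_fin invr_ge0 ltW.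
  - exact: measurable_funeM.
  - by move=> w _; rewrite mule_ge0// lee_fin invr_ge0 ltW.
  - exact: measurable_funeM.
  rewrite !ge0_integralZl//=; last 4 first.
  - by rewrite lee_fin invr_ge0 ltW.
  - by rewrite lee_fin invr_ge0 ltW.
  - exact/measurable_EFinP/measurable_indic.
  - by rewrite lee_fin ltW.
  have -> : \int[pi]_w (\1_A w)%:E = (fine (pi A))%:E.
    by rewrite integral_indic// setIT fineK.
  rewrite (integral_coupling_fst c (msq1 x0))//.
  rewrite (integral_coupling_snd c (msq1 x0))// r1 rt.
  have : 0 <= cost pi by exact: integral_ge0.
  move: cpi; rewrite /cost; case: (integral _ _ _) => [s||]// + _.
  rewrite -(fineK fA) -!EFinM -!EFinD !lee_fin lte_fin /=.
  move: (fine (pi A)) => p Hs Hp.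
  have Hs' : ((1 - t)^-1 * s <= (1 - t) * r + e / 2 * del k)%R.
    rewrite ler_pdivrMl//; apply: le_trans (ltW Hs) _.
    by rewrite [leRHS](_ : _ = (1 - t) ^+ 2 * r + eps)%R// /eps; ring.
  have tt : (t^-1 * (t ^+ 2 * r) = t * r)%R by field; rewrite gt_eqF.
  rewrite -(ler_pM2l (del0 k)); move: Hs' Hp; rewrite tt.
  move: ((1 - t)^-1 * s)%R => q; rewrite mulrBl mul1r (mulrC (del k) (e / 2)%R).
  move: (t * r)%R (e / 2 * del k)%R (del k * p)%R => a b w H1 H2; lra.
rewrite -c1// /pushforward.
apply: (@le_trans _ _ (pi (A `|` snd @^-1` (K k)))).
  apply: le_measure; rewrite ?inE//; first exact: measurableU.
  by move=> w Vw; have [Kw|Kw] := pselect ((snd @^-1` K k) w); [right|left].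
apply: le_trans (measureU2 _ _ _) _ => //.
rewrite (splitr e) EFinD leeD//.
by rewrite -(c2 (K k)) in mKk.
Qed.

Lemma wasserstein_geodesic_concentrated (mu : R -> probability (borel X) R)
    x0 (t : R) (Z M : set (borel X)) :
  wasserstein_geodesic mu -> measure_eq (mu 0%R) (dirac (x0 : borel X)) ->
  (0 < t)%R -> (t < 1)%R -> closed (Z : set X) ->
  measurable M -> mu 1%R M = 0 ->
  (forall y z : X, ~ M y ->
    mdist x0 z = (t * mdist x0 y)%R -> mdist z y = ((1 - t) * mdist x0 y)%R ->
    Z z) ->
  mu t (~` Z) = 0.
Proof.
move=> gmu mu0E t0 t1 cZ mM M0 intZ.
have [F [cF _ FE]] := open_closed_exhaustion (closed_openC cZ).
have F0 n : mu t (F n) = 0.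
  apply: (wasserstein_geodesic_avoids_closed gmu mu0E t0 t1 (cF n) mM M0).
  move=> y z My Fz xz zy; have : (~` Z) z by rewrite -FE; exists n.
  by apply; exact: intZ My xz zy.
apply/eqP; rewrite eq_le measure_ge0 andbT -FE.
have mF n : measurable (F n : set (borel X)) by exact: measurable_closed_borel.
apply: (@le_trans _ _ (\sum_(n <oo) mu t (F n))).
  apply: (@measure_sigma_subadditive _ _ _ (mu t) (\bigcup_n F n) F) => //.
  exact: bigcupT_measurable.
by rewrite eseries0// => n _ _; exact: F0.
Qed.

End coupling_concentration.

(** * Entropy for powers of the density *)

Section power_entropy.
Context {R : realType}.

(** This is the convexity of [r^(1/b)] at the points [x^b] and [y^b]. *)
Lemma powR_concave (b x y t : R) : 0 < b -> b <= 1 -> 0 <= x -> 0 <= y ->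
  0 <= t -> t <= 1 ->
  t * x `^ b + (1 - t) * y `^ b <= (t * x + (1 - t) * y) `^ b.
Proof.
move=> b0 b1 x0 y0 t0 t1.
have t1' : 0 <= 1 - t by rewrite subr_ge0.
have bV1 : 1 <= b^-1 by rewrite invf_ge1.
have bV0 : 0 <= b^-1 by rewrite invr_ge0 ltW.
have i01 : Itv.spec (@Itv.num_sem R) (Itv.Real `[0%Z, 1%Z]) t.
  by rewrite /Itv.spec/= /Itv.num_sem/= num_real/= in_itv/= t0 t1.
have := convex_powR bV1 (Itv.mk i01) (x := x `^ b) (y := y `^ b).
rewrite !inE/= !in_itv/= !andbT !powR_ge0 => /(_ isT isT).
rewrite !convRE/= /unstable.onem -!powRrM mulfV ?gt_eqF// !powRr1// => H.
have H0 : 0 <= t * x `^ b + (1 - t) * y `^ b.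
  by rewrite addr_ge0// mulr_ge0// powR_ge0.
have := @ge0_ler_powR R b (ltW b0) _ _ _ _ H.
rewrite !nnegrE powR_ge0 => /(_ isT); rewrite addr_ge0 ?mulr_ge0// => /(_ isT).
by rewrite -powRrM mulVf ?gt_eqF// powRr1.
Qed.

Lemma continuous_powR_ge0 (b : R) : 0 < b ->
  {within (`[0, +oo[ : set R), continuous (fun r : R => r `^ b)}.
Proof.
move=> b0; apply/continuous_within_itvcyP; split.
- move=> x x0.
  have := derivable_powR (v := 1) (x := b) x0.
  by move=> /derivable1_diffP/differentiable_continuous.
- by rewrite powR0 ?gt_eqF//; exact: powR_cvg0.
Qed.

(** For this [U] the function [l^N * U (l^(- N))] is [- l^(N * (1 - a))],
    whose exponent lies between [0] and [1]. *)
Lemma DC_powR (N a : R) : 0 < a -> a < 1 -> 0 < N -> N * (1 - a) <= 1 ->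
  DC N (fun r => - r `^ a).
Proof.
move=> a0 a1 N0 Na; split.
- move=> x; apply: cvgN; exact: continuous_powR_ge0.
- move=> t x y; rewrite !inE/= !in_itv/= !andbT => x0 y0.
  rewrite !convRE !mulrN -opprD lerN2.
  by apply: powR_concave => //; exact: ltW.
- by rewrite powR0 ?oppr0// gt_eqF.
- move=> t x y; rewrite !inE/= !in_itv/= !andbT => x0 y0.
  have E l : 0 < l -> l `^ N * - (l `^ (- N)) `^ a = - l `^ (N * (1 - a)).
    move=> l0; rewrite mulrN -powRrM -powRD; last first.
      by rewrite (gt_eqF l0) implybT.
    by congr (- _ `^ _); rewrite mulrBr mulr1 mulNr.
  rewrite E; last first.
    exact: convR_gt0.
  rewrite E// E// !convRE !mulrN -opprD lerN2.
  apply: powR_concave => //; try exact: ltW.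
  by rewrite mulr_gt0// subr_gt0.
Qed.

Lemma slope_at_infinity_powR (a : R) : a < 1 ->
  slope_at_infinity (fun r : R => - r `^ a) = 0%E.
Proof.
move=> a1; apply: cvg_lim => //; apply: cvg_EFin.
  by near=> r.
rewrite (_ : fine \o _ = fun r : R => - r `^ a / r); last exact/funext.
apply/cvgr0Pnorm_le => e e0; near=> r.
have r0 : 0 < r by near: r; exact: nbhs_pinfty_gt.
have a10 : 0 < 1 - a by rewrite subr_gt0.
rewrite mulNr normrN ger0_norm ?divr_ge0 ?powR_ge0 ?(ltW r0)//.
rewrite -{2}(powRr1 (ltW r0)) -powRB ?(gt_eqF r0) ?implybT//.
rewrite -opprB powRN.
rewrite -[leRHS]invrK lef_pV2 ?posrE ?invr_gt0 ?powR_gt0//.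
have -> : e^-1 = ((e^-1) `^ (1 - a)^-1) `^ (1 - a).
  by rewrite -powRrM mulVf ?gt_eqF// powRr1// invr_ge0 ltW.
apply: ge0_ler_powR; rewrite ?nnegrE ?powR_ge0 ?ltW//.
Unshelve. all: by end_near. Qed.

Section estimates.
Context d (T : measurableType d).
Local Open Scope ereal_scope.
Implicit Types nu mu : probability T R.

Let mpow (rho : T -> R) (a : R) : measurable_fun [set: T] rho ->
  measurable_fun [set: T] (fun x => (rho x `^ a)%:E).
Proof.
move=> mr; apply/measurable_EFinP.
exact: (measurableT_comp (@measurable_powR R a)).
Qed.

Lemma lebesgue_decomposition_null_compl nu mu rho mus (Z : set T) :
  lebesgue_decomposition nu mu rho mus -> measurable Z -> mu (~` Z) = 0 ->
  {ae nu, forall x, ~ Z x -> rho x = 0%R}.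
Proof.
move=> [mr r0 _ E] mZ muZ.
have mZC := measurableC mZ.
have : \int[nu]_(x in ~` Z) `|(rho x)%:E| = 0.
  under eq_integral do rewrite gee0_abs ?lee_fin//.
  apply/eqP; rewrite eq_le integral_ge0 ?andbT; last first.
    by move=> x _; rewrite lee_fin.
  by rewrite -muZ E// leeDl.
have mrZ : measurable_fun (~` Z) (fun x => (rho x)%:E).
  by apply/measurable_EFinP; exact: measurable_funTS.
move=> /(ae_eq_integral_abs nu mZC mrZ); apply: filterS => x /= H nZx.
by have [] := H nZx.
Qed.

(** This is Young's inequality [l * r^a <= a * r + (1 - a) * l^(1 / (1 - a))]
    integrated over [Z], off which [rho] vanishes almost everywhere. *)
Lemma integral_density_powR_young nu mu rho mus (Z : set T) (a l : R) :
  (0 < a)%R -> (a < 1)%R -> (0 < l)%R ->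
  lebesgue_decomposition nu mu rho mus -> measurable Z -> mu (~` Z) = 0 ->
  l%:E * \int[nu]_x (rho x `^ a)%:E <=
    (a + (1 - a) * l `^ (1 - a)^-1 * fine (nu Z))%:E.
Proof.
move=> a0 a1 l0 D mZ muZ; have rZ := lebesgue_decomposition_null_compl D mZ muZ.
have [mr r0 _ E] := D.
have a10 : (0 < 1 - a)%R by rewrite subr_gt0.
set C := ((1 - a) * l `^ (1 - a)^-1)%R.
have C0 : (0 <= C)%R by rewrite mulr_ge0 ?powR_ge0// ltW.
rewrite -ge0_integralZl//; last 3 first.
- exact: mpow.
- by move=> x _; rewrite lee_fin powR_ge0.
- by rewrite lee_fin ltW.
have mR : measurable_fun [set: T] (fun x => (rho x)%:E).
  exact/measurable_EFinP.
have mI : measurable_fun [set: T] (fun x => (\1_Z x)%:E : \bar R).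
  exact/measurable_EFinP/measurable_indic.
apply: (@le_trans _ _ (\int[nu]_x (a%:E * (rho x)%:E + C%:E * (\1_Z x)%:E))).
  apply: ae_ge0_le_integral => //.
  - by move=> x _; rewrite mule_ge0// lee_fin ?powR_ge0// ltW.
  - by apply: measurable_funeM; exact: mpow.
  - by move=> x _; rewrite adde_ge0// mule_ge0// lee_fin// ltW.
  - by apply: emeasurable_funD; exact: measurable_funeM.
  apply: filterS rZ => x rZ _; rewrite -!EFinM -EFinD lee_fin indicE.
  have [xZ|] := boolP (x \in Z); last first.
    by rewrite notin_setE => /rZ ->; rewrite powR0 ?gt_eqF// !mulr0 addr0.
  rewrite mulr1 mulrC.
  have := @conjugate_powR R (rho x `^ a)%R l a^-1%R (1 - a)^-1%R
    (powR_ge0 _ _) (ltW l0).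
  rewrite !invr_gt0 !invrK => /(_ a0 a10 (subrKC _ _)).
  rewrite -powRrM mulfV ?gt_eqF// powRr1//.
  by rewrite /C (mulrC (rho x)) (mulrC (l `^ _)%R).
rewrite ge0_integralD//; last 4 first.
- by move=> x _; rewrite mule_ge0// lee_fin// ltW.
- exact: measurable_funeM.
- by move=> x _; rewrite mule_ge0// lee_fin.
- exact: measurable_funeM.
rewrite !ge0_integralZl//; last 2 first.
- by move=> x _; rewrite lee_fin.
- by rewrite lee_fin ltW.
have -> : \int[nu]_x (\1_Z x)%:E = (fine (nu Z))%:E.
  by rewrite integral_indic// setIT fineK// fin_num_measure.
rewrite EFinD EFinM leeD2r// -[leRHS]mule1 lee_pmul2l//.
by rewrite -(probability_setT mu) E// leeDl.
Qed.

Lemma integral_density_powR_le nu mu rho mus (Z : set T) (a : R) :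
  (0 < a)%R -> (a < 1)%R ->
  lebesgue_decomposition nu mu rho mus -> measurable Z -> mu (~` Z) = 0 ->
  \int[nu]_x (rho x `^ a)%:E <= (fine (nu Z) `^ (1 - a))%:E.
Proof.
move=> a0 a1 D mZ muZ.
have a10 : (0 < 1 - a)%R by rewrite subr_gt0.
have H l l0 := integral_density_powR_young a0 a1 (l := l) l0 D mZ muZ.
have : 0 <= \int[nu]_x (rho x `^ a)%:E.
  by apply: integral_ge0 => x _; rewrite lee_fin powR_ge0.
have : (0 <= fine (nu Z))%R by exact: fine_ge0.
move: H; move: (\int[nu]_x (rho x `^ a)%:E) (fine (nu Z)) => J z H z0 J0.
have Jfin : J \is a fin_num.
  have := H 1%R ltr01; rewrite mul1e ge0_fin_numE// => /le_lt_trans; apply.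
  by rewrite ltry.
move: J0 H; rewrite -(fineK Jfin) !lee_fin; move: (fine J) => j j0 H.
have {}H l : (0 < l)%R -> (l * j <= a + (1 - a) * l `^ (1 - a)^-1 * z)%R.
  by move=> /H; rewrite -EFinM lee_fin.
(* The best parameter is [z^(- (1 - a))]; if [z = 0], any large one will do. *)
move: z0; rewrite le_eqVlt => /predU1P[z0|z0].
  rewrite -z0 powR0 ?gt_eqF// leNgt; apply/negP => j0'.
  have := H j^-1%R; rewrite invr_gt0 => /(_ j0').
  by rewrite mulVf ?gt_eqF// -z0 mulr0 addr0 leNgt a1.
have := H (z `^ (- (1 - a)))%R (powR_gt0 _ z0).
rewrite -powRrM mulNr mulfV ?gt_eqF// powR_inv1 ?(ltW z0)// -mulrA.
rewrite mulVf ?gt_eqF//.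
rewrite mulr1 subrKC powRN mulrC ler_pdivrMr ?powR_gt0//.
by rewrite mul1r.
Qed.

End estimates.

Section entropies.
Context {X : pmetricType R}.
Local Open Scope ereal_scope.
Variables (N a : R).
Hypotheses (a0 : (0 < a)%R) (a1 : (a < 1)%R) (N0 : (0 < N)%R)
  (Na : (N * (1 - a) <= 1)%R).
Implicit Types nu mu : probability (borel X) R.

Let entropy_powRE nu mu rho mus : lebesgue_decomposition nu mu rho mus ->
  entropy (fun r => - r `^ a)%R nu mu = - \int[nu]_x (rho x `^ a)%:E.
Proof.
move=> D; rewrite (entropyE (DC_powR a0 a1 N0 Na) D) slope_at_infinity_powR//.
rewrite mul0e adde0 -integral_ge0N// => x _; rewrite lee_fin powR_ge0//.
Qed.

Lemma entropy_powR_le0 nu mu : entropy (fun r => - r `^ a)%R nu mu <= 0.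
Proof.
have [rho [mus D]] := lebesgue_decomposition_exists nu mu.
rewrite (entropy_powRE D) oppe_le0; apply: integral_ge0 => x _.
by rewrite lee_fin powR_ge0.
Qed.

Lemma entropy_powR_ge nu mu (Z : set (borel X)) :
  measurable Z -> mu (~` Z) = 0 ->
  - (fine (nu Z) `^ (1 - a))%:E <= entropy (fun r => - r `^ a)%R nu mu.
Proof.
move=> mZ muZ; have [rho [mus D]] := lebesgue_decomposition_exists nu mu.
rewrite (entropy_powRE D) leeN2.
exact: (integral_density_powR_le a0 a1 D mZ muZ).
Qed.

Lemma entropy_powR_uniform nu mu (A : set (borel X)) :
  measurable A -> 0 < nu A ->
  (forall B, measurable B -> mu B = nu (B `&` A) * ((fine (nu A))^-1)%:E) ->
  entropy (fun r => - r `^ a)%R nu mu = - (fine (nu A) `^ (1 - a))%:E.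
Proof.
move=> mA nuA muE; set v := fine (nu A).
have fA : nu A \is a fin_num by exact: fin_num_measure.
have v0 : (0 < v)%R by rewrite fine_gt0// nuA ltey_eq fA.
have D : lebesgue_decomposition nu mu (fun x => v^-1 * \1_A x)%R mzero.
  split.
  - by apply: measurable_funM => //; exact: measurable_indic.
  - by move=> x; rewrite mulr_ge0// invr_ge0 ltW.
  - by exists set0 => //; split; rewrite ?measure0.
  - move=> B mB; transitivity (nu (B `&` A) * (v^-1)%:E); first exact: muE.
    rewrite /mzero adde0.
    under eq_integral do rewrite EFinM.
    rewrite ge0_integralZl//; last 2 first.
    + apply/measurable_EFinP; apply: measurable_funTS.
      exact: measurable_indic.
    + by rewrite lee_fin invr_ge0 ltW.
    by rewrite integral_indic// muleC setIC.
rewrite (entropy_powRE D); congr (- _).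
have E x : ((v^-1 * \1_A x) `^ a)%:E = (v^-1 `^ a)%:E * (\1_A x)%:E.
  rewrite indicE; case: (x \in A); rewrite ?mulr1 ?mule1//.
  by rewrite !mulr0 mule0 powR0// gt_eqF.
under eq_integral do rewrite E.
rewrite ge0_integralZl//; last 2 first.
- exact/measurable_EFinP/measurable_indic.
- by rewrite lee_fin powR_ge0.
rewrite integral_indic// setIT [X in _ * X](_ : _ = v%:E); last first.
  by rewrite fineK.
rewrite -EFinM; congr (_%:E).
rewrite -(powR_inv1 (ltW v0)) -powRrM -[X in (_ * X)%R](powRr1 (ltW v0)).
rewrite -powRD; last by rewrite (gt_eqF v0) implybT.
by rewrite mulN1r addrC.
Qed.

End entropies.
End power_entropy.

(** * Generalities on probabilities *)

Section probability_constructions.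
Context {R : realType}.
Local Open Scope ereal_scope.

Lemma exists_pushforward_probability d d' (T : measurableType d)
    (T' : measurableType d') (P : probability T R) (f : T -> T') :
  measurable_fun [set: T] f ->
  exists Q : probability T' R, forall A, Q A = P (f @^-1` A).
Proof.
move=> mf; exists (distribution P (mfun_Sub (mem_set mf))) => A.
by [].
Qed.

Lemma mnormalize_mrestrE d (T : measurableType d) (P Q : probability T R)
    (A : set T) (mA : measurable A) : 0 < P A ->
  forall B, mnormalize (mrestr P mA) Q B = P (B `&` A) * ((fine (P A))^-1)%:E.
Proof.
move=> PA B; have fA : P A < +oo by rewrite ltey_eq fin_num_measure.
rewrite /mnormalize.
have E : mrestr P mA [set: T] = P A by rewrite /mrestr setTI.
rewrite /= E.
by rewrite (gt_eqF PA) (lt_eqF fA).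
Qed.

(** The integral of a nonnegative function is the supremum of the integrals of
    the simple functions below it; hence the bound for every [f], measurable or
    not. *)
Lemma ge0_integral_le_cst d (T : measurableType d)
    (P : {measure set T -> \bar R}) (D : set T) (f : T -> \bar R) (k : \bar R) :
  measurable D ->
  (forall x, D x -> 0 <= f x <= k) -> \int[P]_(x in D) f x <= k * P D.
Proof.
move=> mD fk; rewrite -integral_cst// !ge0_integralE; last 2 first.
- by move=> x /fk/andP[]; exact: le_trans.
- by move=> x /fk/andP[].
apply: ereal_sup_le => _ [h hf <-]; exists h => // x.
apply: le_trans (hf x) _; rewrite !patchE; case: ifPn => // /set_mem /fk.
by case/andP.
Qed.

End probability_constructions.

Section support.
Context {R : realType} {X : pmetricType R}.
Local Open Scope ereal_scope.

(** The complement of the support is the union of the null sets in a countable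
    basis. *)
Lemma ae_msupport (nu : probability (borel X) R) : compact [set: X] ->
  {ae nu, forall x, msupport nu x}.
Proof.
move=> cX.
have [B cB [oB basB]] : @second_countable X.
  exact: (@compact_second_countable R).
have /countable_injP[f injf] := cB.
pose F n : set (borel X) :=
  \bigcup_(V in [set V | [/\ B V, nu V = 0 & f V = n]]) V.
have FE n : F n = set0 \/ exists2 V, B V /\ nu V = 0 & F n = V.
  have [E|/set0P[V [BV V0 fV]]] :=
      eqVneq [set V | [/\ B V, nu V = 0 & f V = n]] set0.
    by left; rewrite /F E bigcup_set0.
  right; exists V => //; rewrite /F.
  rewrite (_ : [set V | _] = [set V]) ?bigcup_set1//.
  apply/seteqP; split => [W [BW _ fW]|_ -> //].
  by apply: injf; rewrite ?inE// fW fV.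
have mF n : measurable (F n).
  have [->//|[V [BV _] ->]] := FE n.
  by apply: measurable_open_borel; exact: oB.
have F0 n : nu (F n) = 0 by have [->|[V [_ V0] ->]] := FE n; rewrite ?measure0.
exists (\bigcup_n F n); split; first exact: bigcupT_measurable.
  apply/eqP; rewrite eq_le measure_ge0 andbT.
  apply: (@le_trans _ _ (\sum_(n <oo) nu (F n))).
    apply: (@measure_sigma_subadditive _ _ _ nu (\bigcup_n F n) F) => //.
    exact: bigcupT_measurable.
  by rewrite eseries0// => n _ _; exact: F0.
move=> x /= /existsNP[A /not_implyP[oA /not_implyP[Ax nA]]].
have [V [BV Vx] VA] := basB x A (open_nbhs_nbhs (conj oA Ax)).
exists (f V) => //; exists V => //; split => //.
apply: (@subset_measure0 _ _ _ nu _ A) => //.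
- by apply: measurable_open_borel; exact: oB.
- exact: measurable_open_borel.
- by apply/eqP; rewrite eq_le measure_ge0 andbT leNgt; apply/negP.
Qed.

End support.

(** * Contraction of volume along geodesics *)

Section contraction.
Context {R : realType} {X : pmetricType R}.
Context (nu : probability (borel X) R) (N : R).
Hypotheses (cX : compact [set: X]) (N1 : (1 <= N)%R)
  (RicN : nonnegative_Ricci N nu).
Local Open Scope ereal_scope.

(** Apply the curvature hypothesis to the Dirac mass at [x0] and the uniform
    measure on [A], with the entropies of [- r^(1 - 1/s)] for [s > N], then let
    [s] decrease to [N]. *)
Lemma Ricci_contraction_closed x0 (t : R) (A Z M : set (borel X)) :
  msupport nu x0 -> (0 < t)%R -> (t < 1)%R -> measurable A ->
  closed (Z : set X) -> measurable M -> nu M = 0 ->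
  (forall y z : X, A y -> ~ M y ->
    mdist x0 z = (t * mdist x0 y)%R -> mdist z y = ((1 - t) * mdist x0 y)%R ->
    Z z) ->
  (t `^ N)%:E * nu A <= nu Z.
Proof.
move=> x0nu t0 t1 mA cZ mM M0 intZ.
have [->|A0] := eqVneq (nu A) 0; first by rewrite mule0.
have nuA : 0 < nu A by rewrite lt0e A0 measure_ge0.
have fA : nu A \is a fin_num by exact: fin_num_measure.
pose mu1 : probability (borel X) R := mnormalize (mrestr nu mA) nu.
have mu1E B : mu1 B = nu (B `&` A) * ((fine (nu A))^-1)%:E.
  exact: mnormalize_mrestrE.
have mZ : measurable Z by exact: measurable_closed_borel.
pose dx0 : probability (borel X) R := dirac (x0 : borel X).
have supp0 : msupport dx0 `<=` msupport nu.
  move=> x x0x B oB Bx; apply: x0nu => //.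
  have := x0x B oB Bx; rewrite /dx0/= diracE; case: (boolP (_ \in B)).
    by rewrite inE.
  by rewrite ltxx.
have supp1 : msupport mu1 `<=` msupport nu.
  move=> x xmu1 B oB Bx; have := xmu1 B oB Bx.
  rewrite mu1E => H; have mB : measurable (B : set (borel X)).
    exact: measurable_open_borel.
  apply: (@lt_le_trans _ _ (nu (B `&` A))); last first.
    by apply: le_measure; rewrite ?inE//; exact: measurableI.
  rewrite lt0e measure_ge0 andbT; apply/eqP => BA0.
  by move: H; rewrite BA0 mul0e ltxx.
have [mu [gmu mu0E mu1E' Hent]] := RicN supp0 supp1.
have mM' : measurable (M `|` ~` A).
  by apply: measurableU => //; exact: measurableC.
have mut : mu t (~` Z) = 0.
  apply: (wasserstein_geodesic_concentrated cX gmu mu0E t0 t1 cZ mM').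
    rewrite mu1E'// mu1E setIUl setICl setU0.
    rewrite (_ : nu _ = 0) ?mul0e//.
    by apply: (@subset_measure0 _ _ _ nu _ M) => //; exact: measurableI.
  move=> y z /not_orP[My /contrapT Ay]; exact: intZ.
have t01 : t \in `[0%R, 1%R] by rewrite in_itv/= !ltW.
have fZ : nu Z \is a fin_num by exact: fin_num_measure.
set v := fine (nu A); set w := fine (nu Z).
have v0 : (0 < v)%R by rewrite fine_gt0// nuA ltey_eq fA.
have w0 : (0 <= w)%R by exact: fine_ge0.
have est (s : R) : (N < s)%R -> (t `^ s * v <= w)%R.
  move=> Ns.
  have s0 : (0 < s)%R by rewrite (lt_trans _ Ns)// (lt_le_trans _ N1).
  have N0 : (0 < N)%R by exact: lt_le_trans N1.
  pose a : R := (1 - s^-1)%R.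
  have aE : (1 - a = s^-1)%R by rewrite /a opprB addrC subrK.
  have a1 : (a < 1)%R by rewrite -subr_gt0 aE invr_gt0.
  have a0 : (0 < a)%R by rewrite subr_gt0 invf_lt1// (le_lt_trans N1).
  have Na : (N * (1 - a) <= 1)%R by rewrite aE ler_pdivrMr// mul1r ltW.
  have := Hent _ (DC_powR a0 a1 N0 Na) t t01.
  rewrite (@entropy_powR_uniform R X N a a0 a1 N0 Na nu mu1 A)//.
  move/(le_trans (entropy_powR_ge a0 a1 N0 Na nu mZ mut)).
  have e0 : (1 - t)%:E * entropy (fun r => - r `^ a)%R nu dx0 <= 0.
    apply: mule_ge0_le0; first by rewrite lee_fin subr_ge0 ltW.
    exact: (entropy_powR_le0 a0 a1 N0 Na nu dx0).
  move/le_trans => /(_ _ (leeD2r _ e0)).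
  rewrite add0e muleN leeN2 -EFinM lee_fin.
  rewrite aE -/v -/w => H.
  have := @ge0_ler_powR R s (ltW s0) _ _ _ _ H.
  rewrite !nnegrE mulr_ge0 ?powR_ge0 ?(ltW t0)// => /(_ isT isT).
  rewrite powRM ?powR_ge0 ?(ltW t0)// -!powRrM mulVf ?gt_eqF//.
  by rewrite !powRr1// ltW.
rewrite -(fineK fA) -(fineK fZ) -EFinM lee_fin -/v -/w.
apply: (@ler_cvg_to _ N^'+ _ _ (fun s => t `^ s * v)%R (fun=> w)).
- apply: cvgMr_tmp; apply: cvg_at_right_filter.
  rewrite /powR gt_eqF//.
  apply: (@continuous_comp _ _ _ (fun s : R => s * ln t)%R expR).
    by apply: cvgMr_tmp; exact: cvg_id.
  exact: continuous_expR.
- exact: cvg_cst.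
- near=> s; apply: est; near: s; exact: nbhs_right_gt.
Unshelve. all: by end_near. Qed.

(** Closed sets [Z] are handled by [Ricci_contraction_closed] with
    [A := phi @^-1` Z `&` B]; regularity of the image of [nu] under
    [phi] extends the bound to Borel sets. *)
Lemma Ricci_contraction x0 (t : R) (phi : borel X -> borel X)
    (B M : set (borel X)) :
  msupport nu x0 -> (0 < t)%R -> (t < 1)%R ->
  measurable_fun [set: borel X] phi -> measurable B ->
  measurable M -> nu M = 0 ->
  (forall y z : X, ~ M y ->
    mdist x0 z = (t * mdist x0 y)%R -> mdist z y = ((1 - t) * mdist x0 y)%R ->
    z = phi y) ->
  forall Z, measurable Z -> (t `^ N)%:E * nu (phi @^-1` Z `&` B) <= nu Z.
Proof.
move=> x0nu t0 t1 mphi mB mM M0 intphi Z mZ.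
have mpre (W : set (borel X)) : measurable W -> measurable (phi @^-1` W).
  by move=> mW; rewrite -[X in measurable X]setTI; exact: mphi.
have [B0|B0] := eqVneq (nu B) 0.
  rewrite (_ : nu _ = 0) ?mule0//.
  apply: (@subset_measure0 _ _ _ nu _ B) => //.
  by apply: measurableI => //; exact: mpre.
have nuB : 0 < nu B by rewrite lt0e B0 measure_ge0.
have fB : nu B \is a fin_num by exact: fin_num_measure.
pose P : probability (borel X) R := mnormalize (mrestr nu mB) nu.
have [Q QE] := exists_pushforward_probability P mphi.
have v0 : (0 < fine (nu B))%R by rewrite fine_gt0// nuB ltey_eq fB.
have tN : (0 < t `^ N)%R by exact: powR_gt0.
have QE' W : Q W = nu (phi @^-1` W `&` B) * ((fine (nu B))^-1)%:E.
  by rewrite QE [LHS]mnormalize_mrestrE.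
have H F : closed (F : set X) ->
    Q F <= ((t `^ N)^-1 * (fine (nu B))^-1)%:E * nu F.
  move=> cF; rewrite QE' EFinM -muleA (muleC _ (nu F)) muleA.
  apply: lee_wpmul2r; first by rewrite lee_fin invr_ge0 ltW.
  rewrite lee_pdivlMl//.
  apply: (Ricci_contraction_closed x0nu t0 t1 _ cF mM M0) => //.
    by apply: measurableI => //; apply: mpre; exact: measurable_closed_borel.
  by move=> y z [Fy _] My xz zy; rewrite (intphi y z).
have c0 : (0 <= (t `^ N)^-1 * (fine (nu B))^-1)%R.
  by rewrite mulr_ge0// invr_ge0 ltW.
have : Q Z <= ((t `^ N)^-1 * (fine (nu B))^-1)%:E * nu Z.
  exact: measure_le_on_closed c0 H _ mZ.
rewrite QE' EFinM -muleA (muleC _ (nu Z)) muleA lee_pmul2r ?lte_fin ?invr_gt0//.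
by rewrite lee_pdivlMl.
Qed.

End contraction.

(** * The democratic plan *)

Section product_estimates.
Context {R : realType} d (T : measurableType d).
Local Open Scope ereal_scope.

Lemma ae_xsection_null (P Q : probability T R) (E : set (T * T)) :
  measurable E -> (P \x Q) E = 0 -> {ae P, forall x, Q (xsection E x) = 0}.
Proof.
move=> mE E0.
have mf : measurable_fun [set: T] (Q \o xsection E).
  exact: measurable_fun_xsection.
have : \int[P]_x `|(Q \o xsection E) x| = 0.
  by rewrite -[RHS]E0; apply: eq_integral => x _; rewrite gee0_abs.
move=> /(ae_eq_integral_abs P measurableT mf); apply: filterS => x /=.
exact.
Qed.

Lemma product_measure_swap (P Q : probability T R) (E : set (T * T)) :
  measurable E -> (P \x Q) E = \int[Q]_y P (ysection E y).
Proof.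
move=> mE; rewrite (@product_measure_unique _ _ _ _ _ _ _ (P \x^ Q))//.
by move=> A B mA mB; exact: product_measure2E.
Qed.

Lemma ae_ysection_null (P Q : probability T R) (E : set (T * T)) :
  measurable E -> (P \x Q) E = 0 -> {ae Q, forall y, P (ysection E y) = 0}.
Proof.
move=> mE E0.
have mf : measurable_fun [set: T] (P \o ysection E).
  exact: measurable_fun_ysection.
have : \int[Q]_y `|(P \o ysection E) y| = 0.
  rewrite -[RHS]E0 product_measure_swap//.
  by apply: eq_integral => x _; rewrite gee0_abs.
move=> /(ae_eq_integral_abs Q measurableT mf); apply: filterS => x /=.
exact.
Qed.

Lemma integral_ae_le_cst (P : probability T R) (f : T -> \bar R) (k : R) :
  measurable_fun [set: T] f -> (forall x, 0 <= f x) -> (0 <= k)%R ->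
  {ae P, forall x, f x <= k%:E} -> \int[P]_x f x <= k%:E.
Proof.
move=> mf f0 k0 fk; apply: (@le_trans _ _ (\int[P]_x (cst k%:E x))).
  by apply: ae_ge0_le_integral => //; apply: filterS fk.
by rewrite integral_cst// [X in _ * X]probability_setT mule1.
Qed.

End product_estimates.

Section democratic_measures.
Context {R : realType} {X : pmetricType R}.
Context (nu : probability (borel X) R) (N : R).
Hypotheses (cX : compact [set: X]) (lX : is_length_space X) (N1 : (1 <= N)%R)
  (RicN : nonnegative_Ricci N nu).
Variables (c : X) (r : R).
Hypothesis nuB : (0 < nu (ball c r))%E.
Local Open Scope ereal_scope.

Let mu := ball_measure nu c r.
Let v := fine (nu (ball c r)).

Let fB : nu (ball c r) \is a fin_num.
Proof. by apply: fin_num_measure; exact: measurable_metric_ball. Qed.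

Let v0 : (0 < v)%R. Proof. by rewrite fine_gt0// nuB ltey_eq fB. Qed.

Let muE A : mu A = nu (A `&` ball c r) * (v^-1)%:E.
Proof. exact: mnormalize_mrestrE. Qed.

Let mu_le A : measurable A -> mu A <= (v^-1)%:E * nu A.
Proof.
move=> mA; rewrite muE muleC; apply: lee_wpmul2l.
  by rewrite lee_fin invr_ge0 ltW.
apply: le_measure; rewrite ?inE//; apply: measurableI => //.
exact: measurable_metric_ball.
Qed.

Let ae_mu (Q : X -> Prop) : {ae nu, forall x, Q x} -> {ae mu, forall x, Q x}.
Proof.
move=> [M [mM M0 sM]]; exists M; split => //; apply/eqP.
by rewrite eq_le measure_ge0 andbT (le_trans (mu_le mM))// M0 mule0.
Qed.

Variables (S : borel X * borel X -> borel (geodesic X))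
  (E : set (borel X * borel X)%type).
Hypotheses (mS : measurable_fun [set: (borel X * borel X)%type] S)
  (mE : measurable E) (E0 : (nu \x nu) E = 0)
  (SE : forall w, ~ E w -> endpoints (S w) = w /\
      forall h : geodesic X, endpoints h = w -> S w = h).

Let mev t : measurable_fun [set: borel (geodesic X)]
  (ev t : borel (geodesic X) -> borel X).
Proof. by apply: continuous_borel_measurable; exact: continuous_ev. Qed.

Let mW t (A : set (borel X)) : measurable A ->
  measurable [set w | A (ev t (S w))].
Proof.
move=> mA; have := measurableT_comp (mev t) mS.
by move=> /(_ measurableT A mA); rewrite setTI.
Qed.

Let bound_of_contraction (k : R) (A D : set (borel X)) : (0 < k)%R ->
  k%:E * nu (A `&` ball c r) <= nu D -> mu A <= (k^-1 / v)%:E * nu D.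
Proof.
move=> k0 H; rewrite muE EFinM -muleA (muleC _ (nu D)) muleA.
apply: lee_wpmul2r; first by rewrite lee_fin invr_ge0 ltW.
by rewrite lee_pdivlMl.
Qed.

(** Condition on the initial point of the geodesic and apply
    [Ricci_contraction] from there. *)
Lemma interpolant_le_fst (t : R) (A : set (borel X)) :
  (0 < t)%R -> (t < 1)%R -> measurable A ->
  (mu \x mu) [set w | A (ev t (S w))] <= ((t `^ N)^-1 / v)%:E * nu A.
Proof.
move=> t0 t1 mA; set W := [set w | _].
have fA : nu A \is a fin_num by exact: fin_num_measure.
rewrite -(fineK fA) -EFinM.
apply: integral_ae_le_cst.
- by apply: measurable_fun_xsection; exact: mW.
- by [].
- by rewrite mulr_ge0 ?fine_ge0// divr_ge0 ?invr_ge0 ?powR_ge0// ltW.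
apply: ae_mu; have aex := @filterI _ _ (ae_filter_ringOfSetsType nu) _ _
  (ae_msupport nu cX) (ae_xsection_null mE E0).
apply: filterS aex => x [xnu Ex0]; rewrite EFinM fineK//.
apply: bound_of_contraction; first exact: powR_gt0.
have mphi : measurable_fun [set: borel X]
    (fun y : borel X => ev t (S (x, y)) : borel X).
  apply: (measurableT_comp (mev t)); apply: (measurableT_comp mS).
  exact: measurable_pair1.
have -> : xsection W x = (fun y : borel X => ev t (S (x, y)) : borel X) @^-1` A.
  by apply/seteqP; split => y; [move/xsectionP|move=> Ayx; apply/xsectionP].
apply: (Ricci_contraction cX N1 RicN xnu t0 t1 mphi _ _ Ex0) => //.
- exact: measurable_metric_ball.
- exact: measurable_xsection.
- move=> y z nEy xz zy.
  have [_ uS] : endpoints (S (x, y)) = (x, y) /\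
      forall h : geodesic X, endpoints h = (x, y) -> S (x, y) = h.
    by apply: SE => Exy; apply: nEy; exact/xsectionP.
  exact: (unique_geodesic_intermediate cX lX t0 t1 uS xz zy).
Qed.

(** Condition on the final point [y]. A point at time [t] from [x] to [y] is at
    time [1 - t] from [y] to [x], and [Ricci_contraction] applies from [y]. *)
Lemma interpolant_le_snd (t : R) (A : set (borel X)) :
  (0 < t)%R -> (t < 1)%R -> measurable A ->
  (mu \x mu) [set w | A (ev t (S w))] <= (((1 - t) `^ N)^-1 / v)%:E * nu A.
Proof.
move=> t0 t1 mA; set W := [set w | _].
have mWA : measurable W by exact: mW.
have t10 : (0 < 1 - t)%R by rewrite subr_gt0.
have t11 : (1 - t < 1)%R by rewrite ltrBlDr ltrDl.
have fA : nu A \is a fin_num by exact: fin_num_measure.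
rewrite -(fineK fA) -EFinM product_measure_swap//.
apply: integral_ae_le_cst.
- exact: measurable_fun_ysection.
- by [].
- by rewrite mulr_ge0 ?fine_ge0// divr_ge0 ?invr_ge0 ?powR_ge0// ltW.
apply: ae_mu; have aey := @filterI _ _ (ae_filter_ringOfSetsType nu) _ _
  (ae_msupport nu cX) (ae_ysection_null mE E0).
apply: filterS aey => y [ynu Ey0]; rewrite EFinM fineK//.
apply: bound_of_contraction; first exact: powR_gt0.
have mphi : measurable_fun [set: borel X]
    (fun x : borel X => ev t (S (x, y)) : borel X).
  apply: (measurableT_comp (mev t)); apply: (measurableT_comp mS).
  exact: measurable_pair2.
have -> : ysection W y = (fun x : borel X => ev t (S (x, y)) : borel X) @^-1` A.
  by apply/seteqP; split => x; [move/ysectionP|move=> Ayx; apply/ysectionP].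
apply: (Ricci_contraction cX N1 RicN ynu t10 t11 mphi _ _ Ey0) => //.
- exact: measurable_metric_ball.
- exact: measurable_ysection.
- move=> x z nEx; rewrite subKr.
  rewrite (metric_sym y z) (metric_sym z x) (metric_sym y x) => zy xz.
  have [_ uS] : endpoints (S (x, y)) = (x, y) /\
      forall h : geodesic X, endpoints h = (x, y) -> S (x, y) = h.
    by apply: SE => Exy; apply: nEx; exact/ysectionP.
  exact: (unique_geodesic_intermediate cX lX t0 t1 uS xz zy).
Qed.

Let muE0 : (mu \x mu) E = 0.
Proof.
apply/eqP; rewrite eq_le measure_ge0 andbT.
apply: integral_ae_le_cst => //; first exact: measurable_fun_xsection.
apply: ae_mu; apply: filterS (ae_xsection_null mE E0) => x /= Ex0.
have := mu_le (measurable_xsection x mE).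
by rewrite Ex0 mule0.
Qed.

Lemma selector_endpoints (A : set (borel X * borel X)%type) : measurable A ->
  (mu \x mu) [set w | A (endpoints (S w))] = (mu \x mu) A.
Proof.
move=> mA.
have EE : [set w | A (endpoints (S w))] `&` ~` E = A `&` ~` E.
  apply/seteqP; split => w /= [Aw Ew]; split => //; have [Sw _] := SE Ew.
    by rewrite -Sw.
  by rewrite Sw.
have mSA : measurable [set w | A (endpoints (S w))].
  have := measurable_fun_pair
    (measurableT_comp (mev 0%R) mS) (measurableT_comp (mev 1%R) mS).
  by move=> /(_ measurableT A mA); rewrite setTI.
have H (D : set (borel X * borel X)) : measurable D ->
    (mu \x mu) D = (mu \x mu) (D `&` ~` E).
  move=> mD; rewrite (measureDI _ mD mE).
  rewrite [X in _ + X](_ : _ = 0) ?adde0 -?setDE//.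
  by apply: (subset_measure0 _ mE) => //; exact: measurableI.
by rewrite H// EE -H.
Qed.

(** At the times [0] and [1] the interpolant is [mu] itself; at the others one
    of [t] and [1 - t] is at least [1/2]. *)
Lemma interpolant_le (t : R) (A : set (borel X)) :
  t \in `[0%R, 1%R] -> measurable A ->
  (mu \x mu) [set w | A (ev t (S w))] <= (2 `^ N / v)%:E * nu A.
Proof.
rewrite in_itv/= => /andP[t0 t1] mA.
have N0 : (0 < N)%R by exact: lt_le_trans N1.
have two_pow (s : R) : (2^-1 <= s)%R -> ((s `^ N)^-1 / v <= 2 `^ N / v)%R.
  move=> s2; have s0 : (0 < s)%R by rewrite (lt_le_trans _ s2).
  rewrite ler_pM2r ?invr_gt0// -[leRHS]invrK.
  rewrite lef_pV2 ?posrE ?invr_gt0 ?powR_gt0//.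
  rewrite -powRN -mulN1r powRrM powR_inv1//.
  by apply: ge0_ler_powR; rewrite ?nnegrE// ltW.
have le_two_pow k : (k <= 2 `^ N / v)%R ->
    (mu \x mu) [set w | A (ev t (S w))] <= k%:E * nu A ->
    (mu \x mu) [set w | A (ev t (S w))] <= (2 `^ N / v)%:E * nu A.
  by move=> k2 /le_trans; apply; apply: lee_wpmul2r; rewrite ?lee_fin.
have v2 : (v^-1 <= 2 `^ N / v)%R.
  rewrite ler_peMl ?invr_ge0 ?(ltW v0)//.
  have one_pow : (1 `^ N = 1 :> R)%R by rewrite powR1.
  by rewrite -[leLHS]one_pow; apply: ge0_ler_powR; rewrite ?nnegrE ?ler1n// ltW.
move: t0; rewrite le_eqVlt => /predU1P[t0|t0].
  apply: (le_two_pow _ v2); rewrite -t0; apply: le_trans (mu_le mA).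
  have := selector_endpoints (measurableX mA (@measurableT _ (borel X))).
  rewrite [X in _ = X]product_measure1E// [X in _ * X]probability_setT mule1.
  move=> <-.
  by rewrite (_ : [set w | _] = [set w | (A `*` setT) (endpoints (S w))])//;
    apply/seteqP; split => w //= [].
move: t1; rewrite le_eqVlt => /predU1P[t1|t1].
  apply: (le_two_pow _ v2); rewrite t1; apply: le_trans (mu_le mA).
  have := selector_endpoints (measurableX (@measurableT _ (borel X)) mA).
  rewrite [X in _ = X]product_measure1E// [X in X * _]probability_setT mul1e.
  move=> <-.
  by rewrite (_ : [set w | _] = [set w | (setT `*` A) (endpoints (S w))])//;
    apply/seteqP; split => w //= [].
have [t2|/ltW t2] := leP (2^-1)%R t.
  exact: (le_two_pow _ (two_pow _ t2)) (interpolant_le_fst t0 t1 mA).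
apply: (le_two_pow _ (two_pow (1 - t)%R _)) (interpolant_le_snd t0 t1 mA).
lra.
Qed.

End democratic_measures.

Theorem theorem3p1 (R : realType) (X : pmetricType R)
    (nu : probability (borel X) R) (N : R) :
  1 <= N ->
  compact [set: X] -> is_length_space X ->
  nonnegative_Ricci N nu ->
  ae_unique_geodesics nu ->
  DM (2 `^ N) nu.
Proof.
move=> N1 cX lX RicN [E [mE E0 sE]] c r nuB.
have uE z : (~` E) z -> exists! g : geodesic X, endpoints g = z.
  by move=> nEz; apply: contrapT => nu_z; apply: nEz; exact: sE.
have [S [mS SE]] := measurable_geodesic_selector cX (measurableC mE) uE.
have [Pi PiE] := exists_pushforward_probability
  ((ball_measure nu c r \x ball_measure nu c r)%E : probability _ R) mS.
exists Pi => [A mA|A mA].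
  rewrite /pushforward PiE.
  exact: (selector_endpoints nuB mS mE E0 SE mA).
set k := (2 `^ N / fine (nu (ball c r)))%:E.
have : ((k * nu A) * (@lebesgue_measure R) `[0%R, 1%R]%classic <= k * nu A)%E.
  by rewrite lebesgue_measure_itv/= lte_fin ltr01 oppr0 adde0 mule1.
apply: le_trans.
  apply: ge0_integral_le_cst => // t t01; rewrite /pushforward PiE.
  rewrite measure_ge0/=.
  exact: (interpolant_le cX lX N1 RicN nuB mS mE E0 SE t01 mA).
Qed.
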